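(* For $C\in(0,1]$ let $\kappa^C(k,r)=(Ck,r)$, and for $\delta\ge0$ let $\gamma^\delta(k,r)=(k-\delta,3r+\delta)$. (i) If $X\subset Y$ are non-empty, finite subsets of a good metric space, then the normalized degree-Čech bifiltrations $\mathcal{D\check C}(X)$ and $\mathcal{D\check C}(Y)$ are $(\kappa^{|X|/|Y|},\gamma^\delta)$-homotopy interleaved for all $\delta>d_{Pr}(\nu_X,\nu_Y)$. (ii) If $X\subset Y$ are non-empty, finite metric spaces ($X$ with the metric restricted from $Y$), then the normalized degree-Rips bifiltrations $\mathcal{DR}(X)$ and $\mathcal{DR}(Y)$ are $(\kappa^{|X|/|Y|},\gamma^\delta)$-homotopy interleaved for all $\delta>d_{Pr}(\mu_X,\mu_Y)$, where $\mu_X$ is regarded as a measure on $Y$ via pushforward along the inclusion $X\hookrightarrow Y$.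
   Context: **Good metric spaces.** A metric space is good if the intersection of any finite collection of open balls is either empty or contractible. $B(x,r)$ denotes the open ball of radius $r$ centered at $x$. **Measures.** For $X$ a non-empty finite metric space, $\mu_X$ is the uniform probability measure, $\mu_X(A)=|A|/|X|$. If $X\subset Z$ for a metric space $Z$, $\nu_X$ is the Borel measure on $Z$ given by $\nu_X(A)=|A\cap X|/|X|$. The Prohorov distance between Borel measures $\mu,\eta$ on a metric space $Z$ is \[ d_{Pr}(\mu,\eta)=\sup_A\inf\{\delta\ge 0 \mid \mu(A)\le\eta(A^\delta)+\delta \text{ and } \eta(A)\le\mu(A^\delta)+\delta\}, \] where $A\subset Z$ ranges over closed sets and $A^\delta$ is the set of points of $Z$ at distance $<\delta$ from some $a\in A$. **Bifiltrations.** $J=(0,\infty)^{\mathrm{op}}\times(0,\infty)$, so $(k,r)\le(k',r')$ iff $k\ge k'$ and $r\le r'$. All bifiltrations below are functors from $J$ to topological spaces with internal maps inclusions; simplicial complexes are regarded as spaces via geometric realization. - For $X\subset Z$, the Čech complex $\check{\mathcal C}(X)_r$ is the nerve of the balls $B(x,r)\subset Z$, $x\in X$: its vertex set is $X$ (balls are indexed by their centers), and its simplices are the non-empty finite $\sigma\subset X$ with $\bigcap_{x\in\sigma}B(x,r)\ne\emptyset$. - For a metric space $(X,\partial_X)$, the Rips complex $\mathcal R(X)_r$ is the clique complex of the graph with vertex set $X$ and edges $[x,y]$, $x\neq y$, $\partial_X(x,y)<2r$. - For a simplicial complex $T$ and $k>0$, $\mathcal D(T)_k$ is the maximum subcomplex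 of $T$ all of whose vertices have degree at least $k-1$ in the 1-skeleton of $T$. - For $X$ non-empty finite, $\mathcal{D\check C}(X)_{(k,r)}=\mathcal D(\check{\mathcal C}(X)_r)_{k|X|}$ and $\mathcal{DR}(X)_{(k,r)}=\mathcal D(\mathcal R(X)_r)_{k|X|}$. **Interleavings.** A forward shift is a poset automorphism $\gamma$ of $\mathbb R^{\mathrm{op}}\times\mathbb R$ (ordered by $(a,b)\le(c,d)$ iff $a\ge c$ and $b\le d$) with $x\le\gamma(x)$ for all $x\in J$. For forward shifts $\gamma,\kappa$, the thin category $\mathbf I^{\gamma,\kappa}$ has objects $J\times\{0,1\}$ and a morphism $(r,i)\to(s,j)$ iff: $i=j$ and $r\le s$; or $i=0,j=1$ and $\gamma(r)\le s$; or $i=1,j=0$ and $\kappa(r)\le s$. Functors $F,G:J\to\mathbf{Top}$ are $(\gamma,\kappa)$-interleaved if there is a functor $\mathbf I^{\gamma,\kappa}\to\mathbf{Top}$ restricting to $F$ on $J\times\{0\}$ and to $G$ on $J\times\{1\}$. Functors $F,G:J\to\mathbf{Top}$ are weakly equivalent if they are connected by a finite zigzag of natural transformations each of which is objectwise a weak homotopy equivalence. $F,G$ are $(\gamma,\kappa)$-homotopy interleaved if there are $F'$ weakly equivalent to $F$ and $G'$ weakly equivalent to $G$ with $F',G'$ $(\gamma,\kappa)$-interleaved. *)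

(* Defs.v *)
From HB Require Import structures.
From Stdlib Require Import Relation_Operators.
From mathcomp Require Import all_boot all_order all_algebra finmap.
From mathcomp Require Import all_classical all_reals all_analysis.

Set Implicit Arguments.
Unset Strict Implicit.
Unset Printing Implicit Defensive.

Import Order.TTheory GRing.Theory Num.Theory numFieldNormedType.Exports.

Local Open Scope classical_set_scope.
Local Open Scope ring_scope.

(* A preordered type is regarded as a thin category; since [(x <= y)%O] is a
   boolean, there is at most one morphism from x to y.  The library's
   [topologicalType] allows empty spaces. *)
Record functor d (P : preorderType d) := Functor {
  fob :> P -> topologicalType ;
  fmap : forall x y : P, (x <= y)%O -> continuousType (fob x) (fob y) ;
  fmap_id : forall (x : P) (h : (x <= x)%O) (p : fob x), fmap h p = p ;
  fmap_comp : forall (x y z : P) (hxy : (x <= y)%O) (hyz : (y <= z)%O)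
    (hxz : (x <= z)%O) (p : fob x), fmap hxz p = fmap hyz (fmap hxy p)
}.

Definition precomp d d' (P : preorderType d) (Q : preorderType d')
    (F : functor Q) (f : {omorphism P -> Q}) : functor P :=
  @Functor d P (fun x => F (f x)) (fun x y h => fmap F (omorph_le f h))
    (fun x h => @fmap_id _ _ F (f x) (omorph_le f h))
    (fun x y z h h' h'' => @fmap_comp _ _ F (f x) (f y) (f z)
       (omorph_le f h) (omorph_le f h') (omorph_le f h'')).

Section homotopy.
Context {R : realType}.

Definition I01 : topologicalType := set_type [set t : R | 0 <= t <= 1].

Fact mem_I0 : (0 : R) \in [set t : R | 0 <= t <= 1].
Proof. by rewrite inE /= lexx ler01. Qed.
Fact mem_I1 : (1 : R) \in [set t : R | 0 <= t <= 1].
Proof. by rewrite inE /= lexx ler01. Qed.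
Definition I0 : I01 := SigSub mem_I0.
Definition I1 : I01 := SigSub mem_I1.

Definition homotopic_rel (X Y : topologicalType) (A : set X) (f g : X -> Y) :=
  exists H : X * I01 -> Y, [/\ continuous H,
    forall x, H (x, I0) = f x, forall x, H (x, I1) = g x
    & forall x t, A x -> H (x, t) = f x].

Definition homotopic (X Y : topologicalType) (f g : X -> Y) :=
  homotopic_rel set0 f g.

Definition contractible (X : topologicalType) :=
  exists p : X, homotopic (@idfun X) (cst p).

Definition joined_by_path (X : topologicalType) (x y : X) :=
  exists p : I01 -> X, [/\ continuous p, p I0 = x & p I1 = y].

Definition cube (n : nat) : topologicalType := {ptws 'I_n -> I01}.

Definition cube_boundary n : set (cube n) :=
  [set t | exists i, t i = I0 \/ t i = I1].

(* The elements of pi_n(X, x) are the classes of [spheroid n x] modulo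
   [homotopic_rel (@cube_boundary n)]. *)
Definition spheroid n (X : topologicalType) (x : X) : set (cube n -> X) :=
  [set a | continuous a /\ forall t, cube_boundary t -> a t = x].
Arguments spheroid n {X} x.

Definition pi0_bijective (X Y : topologicalType) (f : X -> Y) :=
  (forall x x', joined_by_path (f x) (f x') -> joined_by_path x x') /\
  (forall y, exists x, joined_by_path (f x) y).

(* Bijectivity of f_* : pi_n(X, x) -> pi_n(Y, f x); for n > 0 this map is a
   group morphism, so that it is an isomorphism as soon as it is bijective. *)
Definition pi_bijective n (X Y : topologicalType) (f : X -> Y) (x : X) :=
  (forall a a', spheroid n x a -> spheroid n x a' ->
     homotopic_rel (@cube_boundary n) (f \o a) (f \o a') ->
     homotopic_rel (@cube_boundary n) a a') /\
  (forall b, spheroid n (f x) b -> exists2 a, spheroid n x a &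
     homotopic_rel (@cube_boundary n) (f \o a) b).

Definition weak_homotopy_equivalence (X Y : topologicalType) (f : X -> Y) :=
  [/\ continuous f, pi0_bijective f
    & forall n x, (0 < n)%N -> pi_bijective n f x].

End homotopy.
Arguments I01 : clear implicits.
Arguments contractible : clear implicits.
Arguments weak_homotopy_equivalence R {X Y} f.

Section weak_equivalence.
Context (R : realType) d (P : preorderType d).

Definition objectwise_whe (F G : functor P) :=
  exists eta : forall x, F x -> G x,
    (forall x y (h : (x <= y)%O) (p : F x),
       eta y (fmap F h p) = fmap G h (eta x p)) /\
    (forall x, weak_homotopy_equivalence R (eta x)).

Definition weakly_equivalent : functor P -> functor P -> Prop :=
  clos_refl_sym_trans (functor P) objectwise_whe.

End weak_equivalence.

Section interleavings.
Context {R : realType}.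

(* R^op x R with the product order; the first coordinate of a pair lives in
   the order dual [R^d], which is convertible to R. *)
Definition Rop_R : Type := (R^d *p R)%type.
HB.instance Definition _ := Order.POrder.on Rop_R.

Lemma leRop_RE (x y : Rop_R) :
  (x <= y)%O = ((y.1 : R) <= (x.1 : R)) && ((x.2 : R) <= y.2).
Proof. by []. Qed.

Definition J : Type := {x : Rop_R | (0 < (x.1 : R)) && (0 < (x.2 : R))}.
HB.instance Definition _ := SubChoice.on J.
HB.instance Definition _ :=
  [SubChoice_isSubPOrder of J by <: with Order.Disp tt tt].

Record forward_shift := ForwardShift {
  shift :> Rop_R -> Rop_R ;
  shift_bij : bijective shift ;
  shift_mono : {mono shift : x y / (x <= y)%O} ;
  shift_ge : forall x : J, (val x <= shift (val x))%O
}.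

(* The objects of I^{gamma,kappa}: the tag [false] stands for 0 and [true]
   for 1. *)
Definition interl (gamma kappa : forward_shift) : Type := (J * bool)%type.

Section interl_preorder.
Variables gamma kappa : forward_shift.
HB.instance Definition _ := Choice.on (interl gamma kappa).

Definition interl_le (x y : interl gamma kappa) : bool :=
  match x.2, y.2 with
  | false, true => (gamma (val x.1) <= val y.1)%O
  | true, false => (kappa (val x.1) <= val y.1)%O
  | _, _ => (x.1 <= y.1)%O
  end.

Fact interl_le_refl : reflexive interl_le.
Proof. by case=> x []; rewrite /interl_le /=. Qed.

Fact interl_le_trans : transitive interl_le.
Proof.
move=> [y j] [x i] [z k]; rewrite /interl_le /=.
have lev (a b : J) : (a <= b)%O = (val a <= val b)%O by [].
case: i; case: j; case: k; rewrite ?lev => h1 h2.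
- exact: le_trans h1 h2.
- by apply: le_trans h2; rewrite shift_mono.
- exact: le_trans (le_trans (shift_ge kappa x) h1)
    (le_trans (shift_ge gamma y) h2).
- exact: le_trans h1 h2.
- exact: le_trans h1 h2.
- exact: le_trans (le_trans (shift_ge gamma x) h1)
    (le_trans (shift_ge kappa y) h2).
- by apply: le_trans h2; rewrite shift_mono.
- exact: le_trans h1 h2.
Qed.

HB.instance Definition _ :=
  Order.Le_isPreorder.Build (Order.Disp tt tt) (interl gamma kappa)
    interl_le_refl interl_le_trans.

Definition interl_in (i : bool) (x : J) : interl gamma kappa := (x, i).

Fact interl_in_homo i : {homo interl_in i : x y / (x <= y)%O}.
Proof. by case: i. Qed.

HB.instance Definition _ i :=
  Order.isOrderMorphism.Build _ J _ (interl gamma kappa) (interl_in i)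
    (interl_in_homo i).

End interl_preorder.

Definition interleaved (gamma kappa : forward_shift) (F G : functor J) :=
  exists H : functor (interl gamma kappa),
    precomp H (interl_in gamma kappa false) = F /\
    precomp H (interl_in gamma kappa true) = G.

Definition homotopy_interleaved (gamma kappa : forward_shift)
    (F G : functor J) :=
  exists F' G' : functor J, [/\ weakly_equivalent R F' F,
    weakly_equivalent R G' G & interleaved gamma kappa F' G'].

Definition kappa_fun (C : R) (x : Rop_R) : Rop_R := (C * (x.1 : R), x.2).

Definition gamma_fun (delta : R) (x : Rop_R) : Rop_R :=
  ((x.1 : R) - delta, 3 * (x.2 : R) + delta).

Section shifts.

Fact kappa_bij C : 0 < C <= 1 -> bijective (kappa_fun C).
Proof.
move=> /andP[C0 _]; exists (kappa_fun C^-1) => -[k r]; congr pair => /=.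
  by rewrite mulKf// gt_eqF.
by rewrite mulVKf// gt_eqF.
Qed.

Fact kappa_mono C : 0 < C <= 1 -> {mono kappa_fun C : x y / (x <= y)%O}.
Proof.
by move=> /andP[C0 _] [k r] [k' r']; rewrite !leRop_RE /= ler_pM2l.
Qed.

Fact kappa_ge C : 0 < C <= 1 ->
  forall x : J, (val x <= kappa_fun C (val x))%O.
Proof.
move=> /andP[_ C1] [[k r] /= /andP[k0 r0]]; rewrite leRop_RE /= lexx andbT.
by rewrite ler_piMl// ltW.
Qed.

Definition kappa_shift (C : R) (hC : 0 < C <= 1) : forward_shift :=
  ForwardShift (kappa_bij hC) (kappa_mono hC) (kappa_ge hC).

Fact gamma_bij delta : bijective (gamma_fun delta).
Proof.
exists (fun x => ((x.1 : R) + delta, ((x.2 : R) - delta) / 3)) => -[k r];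
  congr pair => /=.
- by rewrite subrK.
- by rewrite addrK mulrC mulKf.
- by rewrite addrK.
- by rewrite mulrC divfK ?subrK.
Qed.

Fact gamma_mono delta : {mono gamma_fun delta : x y / (x <= y)%O}.
Proof.
by move=> [k r] [k' r']; rewrite !leRop_RE /= !lerD2r ler_pM2l.
Qed.

Fact gamma_ge delta : 0 <= delta ->
  forall x : J, (val x <= gamma_fun delta (val x))%O.
Proof.
move=> d0 [[k r] /= /andP[k0 r0]]; rewrite leRop_RE /= gerBl d0/=.
by rewrite ler_wpDr// ler_peMl ?ltW// ltr1n.
Qed.

Definition gamma_shift (delta : R) (hdelta : 0 <= delta) : forward_shift :=
  ForwardShift (gamma_bij delta) (gamma_mono delta) (gamma_ge hdelta).

End shifts.
End interleavings.
Arguments Rop_R : clear implicits.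
Arguments J : clear implicits.
Arguments kappa_shift {R} C hC.
Arguments gamma_shift {R} delta hdelta.

Section complexes.
Variable V : finType.
Implicit Types s t : {set V}.

Record complex := Complex {
  simplices :> {set {set V}} ;
  complex_set0 : finset.set0 \notin simplices ;
  complex_sub : forall s t, s \in simplices ->
    t \subset s -> t != finset.set0 -> t \in simplices
}.

Definition degree (T : complex) (v : V) : nat :=
  #|[set w | (w != v) && ([set v; w]%SET \in T)]%SET|.

Context {R : realType}.

Definition deg_simplices (T : complex) (k : R) : {set {set V}} :=
  [set s in T | [forall v in s, k - 1 <= (degree T v)%:R]]%SET.

Fact deg_set0 T k : finset.set0 \notin deg_simplices T k.
Proof. by rewrite inE negb_and complex_set0. Qed.

Fact deg_sub T k s t : s \in deg_simplices T k ->
  t \subset s -> t != finset.set0 -> t \in deg_simplices T k.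
Proof.
rewrite !inE => /andP[sT /forall_inP sk] ts t0.
rewrite (complex_sub sT ts t0); apply/forall_inP => v vt.
by apply: sk; exact: (fintype.subsetP ts).
Qed.

Definition deg_complex (T : complex) (k : R) : complex :=
  Complex (@deg_set0 T k) (@deg_sub T k).

Definition vertices_deg_ge (T S : complex) (k : R) :=
  forall v, [set v]%SET \in S -> k - 1 <= (degree T v)%:R.

Lemma deg_complex_max (T : complex) (k : R) :
  [/\ deg_complex T k \subset T, vertices_deg_ge T (deg_complex T k) k
    & forall S : complex, S \subset T -> vertices_deg_ge T S k ->
      S \subset deg_complex T k].
Proof.
split.
- by apply/fintype.subsetP => s; rewrite inE => /andP[].
- by move=> v; rewrite inE => /andP[_ /forall_inP]; apply; rewrite inE.
- move=> S ST Sk; apply/fintype.subsetP => s sS; rewrite inE (fintype.subsetP ST)//=.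
  apply/forall_inP => v vs; apply: Sk; apply: (complex_sub sS).
    by rewrite finset.sub1set.
  by apply/set0Pn; exists v; rewrite inE.
Qed.

Lemma degreeS (T T' : complex) v : T \subset T' ->
  (degree T v <= degree T' v)%N.
Proof.
move=> TT'; apply/subset_leq_card/fintype.subsetP => w; rewrite !inE.
by move=> /andP[-> /(fintype.subsetP TT')].
Qed.

Lemma deg_complexS (T T' : complex) (k k' : R) : T \subset T' -> k' <= k ->
  deg_complex T k \subset deg_complex T' k'.
Proof.
move=> TT' kk'; apply/fintype.subsetP => s; rewrite !inE => /andP[sT /forall_inP sk].
rewrite (fintype.subsetP TT')//=; apply/forall_inP => v vs.
rewrite (le_trans _ (le_trans (sk _ vs) _)) ?lerD2r// ler_nat.
exact: degreeS.
Qed.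

(* Barycentric coordinates; as V is finite, the coherent topology on the
   realization is the one induced by the product topology. *)
Definition realization_set (T : complex) : set {ptws V -> R} :=
  [set b | [/\ forall v, 0 <= b v, \sum_v b v = 1
              & [set v | b v != 0]%SET \in T]].

Definition realization (T : complex) : topologicalType :=
  set_type (realization_set T).

Fact realizationS (T T' : complex) : T \subset T' ->
  realization_set T `<=` realization_set T'.
Proof. by move=> TT' b [b0 b1 bT]; split => //; exact: (fintype.subsetP TT'). Qed.

Fact realization_incl_subproof (T T' : complex) (TT' : T \subset T')
  (b : realization T) : set_val b \in realization_set T'.
Proof. exact/mem_set/(realizationS TT')/set_valP. Qed.

Definition realization_incl (T T' : complex) (TT' : T \subset T')
    (b : realization T) : realization T' :=
  SigSub (realization_incl_subproof TT' b).

Fact realization_incl_continuous (T T' : complex) (TT' : T \subset T') :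
  continuous (realization_incl TT').
Proof.
apply: continuous_comp_initial.
exact: (@initial_continuous _ _ (@set_val _ (realization_set T))).
Qed.

HB.instance Definition _ (T T' : complex) (TT' : T \subset T') :=
  isContinuous.Build _ _ (realization_incl TT')
    (@realization_incl_continuous T T' TT').

Section bifiltration.
Variable K : J R -> complex.
Hypothesis KS : forall x y, (x <= y)%O -> K x \subset K y.

Fact bifiltration_id x (h : (x <= x)%O) (b : realization (K x)) :
  realization_incl (KS h) b = b.
Proof. exact/val_inj. Qed.

Fact bifiltration_comp x y z (hxy : (x <= y)%O) (hyz : (y <= z)%O)
    (hxz : (x <= z)%O) (b : realization (K x)) :
  realization_incl (KS hxz) b =
  realization_incl (KS hyz) (realization_incl (KS hxy) b).
Proof. exact/val_inj. Qed.

Definition bifiltration : functor (J R) :=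
  @Functor _ (J R) (fun x => realization (K x))
    (fun x y h => realization_incl (KS h)) bifiltration_id bifiltration_comp.

End bifiltration.

(* (k, r) |-> D(T r)_{k |V|} *)
Section normalized_degree.
Variable T : R -> complex.
Hypothesis TS : forall r r', r <= r' -> T r \subset T r'.

Definition ndeg_complex (x : J R) : complex :=
  deg_complex (T (val x).2) (((val x).1 : R) * #|V|%:R).

Fact ndeg_complexS (x y : J R) : (x <= y)%O ->
  ndeg_complex x \subset ndeg_complex y.
Proof.
move=> /andP[k r]; apply: deg_complexS; first exact: TS.
exact: ler_wpM2r.
Qed.

Definition ndeg_bifiltration : functor (J R) := bifiltration ndeg_complexS.

End normalized_degree.

End complexes.

HB.structure Definition FinMetric (K : numDomainType) :=
  { T of Metric K T & Finite T }.
Notation finMetricType := FinMetric.type.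

Section fset_metric.
Context {R : realType} {Z : metricType R} (X : {fset Z}).

Let dist (x y : X) : R := mdist (val x) (val y).

Let dist_xx x : dist x x = 0. Proof. exact: mdistxx. Qed.

Let dist_pos x y : dist x y = 0 -> x = y.
Proof. by move=> /mdist_positivity /val_inj. Qed.

Let dist_sym x y : dist x y = dist y x.
Proof. exact: metric_sym. Qed.

Let dist_triangle y x z : dist x z <= dist x y + dist y z.
Proof. exact: metric_triangle. Qed.

HB.instance Definition _ := isMetric.Build R (fset_sub_type X)
  dist_xx dist_pos dist_sym dist_triangle.

Lemma mdist_fsetE (x y : X) : mdist x y = mdist (val x) (val y).
Proof. by []. Qed.

End fset_metric.
HB.instance Definition _ (R : realType) (Z : metricType R) (X : {fset Z}) :=
  FinMetric.on (fset_sub_type X).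

(* "Any finite collection" is read as any non-empty finite collection. *)
Definition good_metric_space (R : realType) (Z : metricType R) :=
  forall D : set (Z * R), finite_set D -> D !=set0 ->
    let U := \bigcap_(p in D) ball p.1 p.2 in
    U = set0 \/ contractible R (set_type U).

Definition borel_set (Z : topologicalType) : set (set Z) := <<s @open Z >>.
Arguments borel_set {Z}.

(* The library's [{measure set _ -> \bar _}] is restricted to pointed types,
   hence this record.  The values on non-Borel sets are irrelevant. *)
Record borel_measure (R : realType) (Z : topologicalType) := BorelMeasure {
  bmeas :> set Z -> \bar R ;
  bmeas0 : bmeas set0 = 0%E ;
  bmeas_ge0 : forall A, borel_set A -> (0 <= bmeas A)%E ;
  bmeas_sigma_additive : forall F : nat -> set Z,
    (forall n, borel_set (F n)) -> trivIset setT F ->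
    (fun n => \sum_(0 <= i < n) bmeas (F i))%E @ \oo -->
      bmeas (\bigcup_n F n)
}.

Section prohorov.
Context {R : realType} {Z : metricType R}.

Definition thickening (A : set Z) (delta : R) : set Z :=
  [set z | exists2 a, A a & mdist z a < delta].

Definition prohorov (mu eta : borel_measure R Z) : \bar R :=
  ereal_sup [set ereal_inf [set delta%:E | delta in [set delta : R |
      [/\ 0 <= delta,
          (mu A <= eta (thickening A delta) + delta%:E)%E
        & (eta A <= mu (thickening A delta) + delta%:E)%E]]]
    | A in @closed Z].

Lemma prohorov_ge0 mu eta : (0 <= prohorov mu eta)%E.
Proof.
apply: (@le_trans _ _ (ereal_inf [set delta%:E | delta in [set delta : R |
      [/\ 0 <= delta,
          (mu set0 <= eta (thickening set0 delta) + delta%:E)%E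
        & (eta set0 <= mu (thickening set0 delta) + delta%:E)%E]]])).
  by apply: le_ereal_inf_tmp => _ [d [d0 _ _] <-]; rewrite lee_fin.
by apply: ereal_sup_ubound; exists set0 => //; exact: closed0.
Qed.

Lemma prohorov_lt_ge0 mu eta (delta : R) :
  (prohorov mu eta < delta%:E)%E -> 0 <= delta.
Proof.
by move=> h; rewrite -lee_fin (le_trans (prohorov_ge0 mu eta))// ltW.
Qed.

End prohorov.

Section indicator_sums.
Context {R : realType} (T : Type) (F : nat -> set T).
Hypothesis tF : trivIset setT F.

Fact sum_indic_near x : exists N, forall n, (N <= n)%N ->
  \sum_(0 <= i < n) (\1_(F i) x : R) = \1_(\bigcup_n F n) x.
Proof.
have [[k _ Fkx]|nFx] := pselect ((\bigcup_n F n) x); last first.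
  exists 0%N => n _; rewrite indicE memNset// big1// => i _.
  by rewrite indicE memNset// => Fix; apply: nFx; exists i.
exists k.+1 => n kn; rewrite [RHS]indicE mem_set; last by exists k.
rewrite big_mkord (bigD1 (Ordinal kn))//= indicE mem_set// big1 ?addr0//.
move=> i ik; rewrite indicE memNset// => Fix.
have := tF Logic.I Logic.I (ex_intro _ x (conj Fix Fkx)).
by move=> ik'; move: ik; rewrite -val_eqE/= ik' eqxx.
Qed.

Fact sum_indic_near_seq (s : seq T) : exists N, forall n, (N <= n)%N ->
  \sum_(0 <= i < n) \sum_(x <- s) (\1_(F i) x : R) =
  \sum_(x <- s) \1_(\bigcup_n F n) x.
Proof.
elim: s => [|x s [N hN]].
  by exists 0%N => n _; rewrite big_nil big1// => i _; rewrite big_nil.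
have [M hM] := sum_indic_near x.
exists (maxn M N) => n; rewrite geq_max => /andP[Mn Nn].
rewrite big_cons -(hM n Mn) -(hN n Nn) -big_split/=.
by apply: eq_bigr => i _; rewrite big_cons.
Qed.

Fact sum_indic_cvg (s : seq T) (c : R) :
  (fun n => \sum_(0 <= i < n)
     ((\sum_(x <- s) (\1_(F i) x : R)) / c)%:E)%E @ \oo -->
  ((\sum_(x <- s) (\1_(\bigcup_n F n) x : R)) / c)%:E.
Proof.
have [N hN] := sum_indic_near_seq s.
apply: cvg_near_cst; exists N => // n /= Nn.
by rewrite sumEFin -mulr_suml hN.
Qed.

End indicator_sums.

Section uniform_measures.
Context {R : realType}.

Section nu.
Context {Z : metricType R} (X : {fset Z}).

Definition nu_fun (A : set Z) : \bar R :=
  (#|` [fset x in X | x \in A]%fset|%:R / #|` X|%:R)%:E.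

Fact nu_funE A :
  nu_fun A = ((\sum_(x <- X) (\1_A x : R)) / #|` X|%:R)%:E.
Proof.
rewrite /nu_fun card_fset_sum1 natr_sum -big_fset_condE big_mkcond/=.
by congr (_ / _)%:E; apply: eq_bigr => x _; rewrite indicE; case: (x \in A).
Qed.

Fact nu_fun0 : nu_fun set0 = 0%E.
Proof.
by rewrite nu_funE big1 ?mul0r// => x _; rewrite indicE in_set0.
Qed.

Fact nu_fun_ge0 A : borel_set A -> (0 <= nu_fun A)%E.
Proof. by rewrite lee_fin divr_ge0. Qed.

Fact nu_fun_sigma_additive (F : nat -> set Z) :
  (forall n, borel_set (F n)) -> trivIset setT F ->
  (fun n => \sum_(0 <= i < n) nu_fun (F i))%E @ \oo -->
    nu_fun (\bigcup_n F n).
Proof.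
move=> _ tF; rewrite nu_funE; under eq_fun do under eq_bigr do rewrite nu_funE.
exact: sum_indic_cvg.
Qed.

Definition nu : borel_measure R Z :=
  BorelMeasure nu_fun0 nu_fun_ge0 nu_fun_sigma_additive.

End nu.

Section mu.
Variable X : finMetricType R.

Definition mu_fun (A : set X) : \bar R :=
  (#|[set x | x \in A]%SET|%:R / #|X|%:R)%:E.

Fact mu_funE A :
  mu_fun A = ((\sum_(x <- enum X) (\1_A x : R)) / #|X|%:R)%:E.
Proof.
rewrite /mu_fun cardsE -sum1_card natr_sum big_mkcond/= big_enum/=.
by congr (_ / _)%:E; apply: eq_bigr => x _; rewrite indicE; case: (x \in A).
Qed.

Fact mu_fun0 : mu_fun set0 = 0%E.
Proof.
by rewrite mu_funE big1 ?mul0r// => x _; rewrite indicE in_set0.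
Qed.

Fact mu_fun_ge0 A : borel_set A -> (0 <= mu_fun A)%E.
Proof. by rewrite lee_fin divr_ge0. Qed.

Fact mu_fun_sigma_additive (F : nat -> set X) :
  (forall n, borel_set (F n)) -> trivIset setT F ->
  (fun n => \sum_(0 <= i < n) mu_fun (F i))%E @ \oo -->
    mu_fun (\bigcup_n F n).
Proof.
move=> _ tF; rewrite mu_funE; under eq_fun do under eq_bigr do rewrite mu_funE.
exact: sum_indic_cvg.
Qed.

Definition mu : borel_measure R X :=
  BorelMeasure mu_fun0 mu_fun_ge0 mu_fun_sigma_additive.

End mu.

Section borel_pushforward.
Context {X Y : topologicalType} (m : borel_measure R X) (f : X -> Y).
Hypothesis cf : continuous f.

Let pf (A : set Y) : \bar R := m (f @^-1` A).

Fact borel_preimage A : borel_set A -> borel_set (f @^-1` A).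
Proof.
suff : (borel_set : set (set Y)) `<=` [set A | borel_set (f @^-1` A)] by apply.
apply: smallest_sub; last first.
  by move=> B oB; apply: sub_sigma_algebra; apply: open_comp.
split.
- by rewrite /= preimage_set0; exact: sigma_algebra0.
- move=> B /= bB; rewrite setTD preimage_setC -setTD.
  exact: sigma_algebraCD.
- move=> B bB /=; rewrite preimage_bigcup.
  exact: sigma_algebra_bigcup.
Qed.

Fact pf0 : pf set0 = 0%E.
Proof. by rewrite /pf preimage_set0 bmeas0. Qed.

Fact pf_ge0 A : borel_set A -> (0 <= pf A)%E.
Proof. by move=> bA; apply: bmeas_ge0; exact: borel_preimage. Qed.

Fact pf_sigma_additive (F : nat -> set Y) :
  (forall n, borel_set (F n)) -> trivIset setT F ->
  (fun n => \sum_(0 <= i < n) pf (F i))%E @ \oo --> pf (\bigcup_n F n).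
Proof.
move=> bF tF; rewrite /pf preimage_bigcup; apply: bmeas_sigma_additive.
  by move=> n; exact: borel_preimage.
by move=> i j _ _ [x [Fix Fjx]]; apply: tF => //; exists (f x).
Qed.

Definition borel_pushforward : borel_measure R Y :=
  BorelMeasure pf0 pf_ge0 pf_sigma_additive.

End borel_pushforward.

Fact fsval_continuous (Z : metricType R) (X : {fset Z}) :
  continuous (val : X -> Z).
Proof.
move=> x U /nbhs_ballP[e e0 eU]; apply/nbhs_ballP; exists e => //= y.
by rewrite ballEmdist => xy; apply: eU; rewrite ballEmdist.
Qed.

End uniform_measures.
Arguments borel_pushforward {R X Y} m f cf.
Arguments fsval_continuous {R Z} X.

Section cech.
Context {R : realType} {Z : metricType R} (X : {fset Z}).

Definition cech_simplices (r : R) : {set {set X}} :=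
  [set s : {set X} | (s != finset.set0) &&
    `[< \bigcap_(x in [set x : X | x \in s]) ball (val x) r !=set0 >] ]%SET.

Fact cech_set0 r : finset.set0 \notin cech_simplices r.
Proof. by rewrite inE eqxx. Qed.

Fact cech_sub r (s t : {set X}) : s \in cech_simplices r -> t \subset s ->
  t != finset.set0 -> t \in cech_simplices r.
Proof.
rewrite !inE => /andP[_ /asboolP[z sz]] ts ->; apply/asboolP; exists z.
by move=> x /= xt; apply: sz; exact: (fintype.subsetP ts).
Qed.

Definition cech (r : R) : complex X := Complex (@cech_set0 r) (@cech_sub r).

Fact cechS r r' : r <= r' -> cech r \subset cech r'.
Proof.
move=> rr'; apply/fintype.subsetP => s; rewrite !inE => /andP[-> /asboolP[z sz]].
apply/asboolP; exists z => x xs; exact: le_ball (sz x xs).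
Qed.

Definition degree_cech : functor (J R) := ndeg_bifiltration cechS.

End cech.

Section rips.
Context {R : realType} (X : finMetricType R).

Definition rips_edge (r : R) : rel X :=
  fun x y => (x != y) && (mdist x y < 2 * r).

(* The clique complex of [rips_edge r]. *)
Definition rips_simplices (r : R) : {set {set X}} :=
  [set s : {set X} | (s != finset.set0) &&
    [forall x in s, forall y in s, (x != y) ==> rips_edge r x y]]%SET.

Fact rips_set0 r : finset.set0 \notin rips_simplices r.
Proof. by rewrite inE eqxx. Qed.

Fact rips_sub r (s t : {set X}) : s \in rips_simplices r -> t \subset s ->
  t != finset.set0 -> t \in rips_simplices r.
Proof.
rewrite !inE => /andP[_ sr] /fintype.subsetP ts ->.
apply/forall_inP => x xt; apply/forall_inP => y yt.
by move/forall_inP : sr => /(_ _ (ts _ xt))/forall_inP/(_ _ (ts _ yt)).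
Qed.

Definition rips (r : R) : complex X := Complex (@rips_set0 r) (@rips_sub r).

Fact ripsS r r' : r <= r' -> rips r \subset rips r'.
Proof.
move=> rr'; apply/fintype.subsetP => s; rewrite !inE => /andP[-> sr].
apply/forall_inP => x xs; apply/forall_inP => y ys; apply/implyP => xy.
move/forall_inP : sr => /(_ _ xs)/forall_inP/(_ _ ys).
rewrite xy /rips_edge xy/= => /lt_le_trans; apply.
by rewrite ler_pM2l.
Qed.

Definition degree_rips : functor (J R) := ndeg_bifiltration ripsS.

End rips.

Section card_ratio.
Context {R : realType}.

Fact card_ratio_fset (Z : choiceType) (X Y : {fset Z}) :
  X != fset0 -> (X `<=` Y)%fset ->
  0 < (#|` X|%:R / #|` Y|%:R : R) <= 1.
Proof.
rewrite -cardfs_gt0 => X0 /fsubset_leq_card XY.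
have Y0 := leq_trans X0 XY.
by rewrite divr_gt0 ?ltr0n//= ler_pdivrMr ?ltr0n// mul1r ler_nat.
Qed.

Fact card_ratio_fin (Y : finType) (X : {fset Y}) :
  X != fset0 -> 0 < (#|` X|%:R / #|Y|%:R : R) <= 1.
Proof.
rewrite -cardfs_gt0 => X0.
have XY : (#|` X| <= #|Y|)%N by rewrite cardfE; exact: (leq_card val val_inj).
have Y0 := leq_trans X0 XY.
by rewrite divr_gt0 ?ltr0n//= ler_pdivrMr ?ltr0n// mul1r ler_nat.
Qed.

End card_ratio.

(* Main.v *)
(* Both bifiltrations are handled through Dowker duality rather than through
   the nerve theorem.  Call a set w of points of Y a witness of a point y at
   scale r if w is a simplex at some scale 0 < s <= r and y is at distance at
   most r - s from some element of w.  A set of vertices spans a simplex at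
   scale r iff its elements have a common witness, so the degree complexes at
   (k, r) are Dowker complexes of relations between points and witnesses, and
   they are naturally weakly equivalent to the dual complexes, whose vertices
   are witnesses.  A set of witnesses of y at scale r witnesses, at scale
   3r + delta, every point x at distance less than 2r + delta from y, and the
   Prohorov bound provides such an x in X with the required degree.  Hence the
   dual complexes of X and Y are interleaved by inclusions.

   The natural weak equivalence between a Dowker complex and its dual is a
   zigzag of inclusions into a complex on the disjoint union of the two vertex
   sets (the simplices are the joins of a simplex and a dual simplex whose
   vertices are pairwise related).  Each realization is a strong deformation
   retract, by an explicit formula in barycentric coordinates. *)
Require Import Defs.
From HB Require Import structures.
From Stdlib Require Import Relation_Operators.
From mathcomp Require Import all_boot all_order all_algebra finmap.
From mathcomp Require Import all_classical all_reals all_analysis.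
From mathcomp Require Import lra.

Set Implicit Arguments.
Unset Strict Implicit.
Unset Printing Implicit Defensive.

Import Order.TTheory GRing.Theory Num.Theory numFieldNormedType.Exports.
Local Open Scope classical_set_scope.
Local Open Scope ring_scope.

(** * Continuity and homotopies *)

Section real_valued_maps.
Context {R : realType} {X : topologicalType}.
Implicit Types f g : X -> R.

Lemma cst_cont (c : R) : continuous (fun _ : X => c).
Proof. by move=> x; exact: cvg_cst. Qed.

Lemma add_cont f g : continuous f -> continuous g ->
  continuous (fun x => f x + g x).
Proof. by move=> cf cg x; apply: continuousD; [exact: cf|exact: cg]. Qed.

Lemma sub_cont f g : continuous f -> continuous g ->
  continuous (fun x => f x - g x).
Proof. by move=> cf cg x; apply: continuousB; [exact: cf|exact: cg]. Qed.

Lemma mul_cont f g : continuous f -> continuous g ->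
  continuous (fun x => f x * g x).
Proof. by move=> cf cg x; apply: continuousM; [exact: cf|exact: cg]. Qed.

Lemma div_cont f g : (forall x, g x != 0) -> continuous f -> continuous g ->
  continuous (fun x => f x / g x).
Proof.
move=> g0 cf cg; apply: mul_cont => // x.
by apply: continuousV; [exact: g0|exact: cg].
Qed.

Lemma max_cont f g : continuous f -> continuous g ->
  continuous (fun x => Num.max (f x) (g x)).
Proof. by move=> cf cg x; apply: continuous_max; [exact: cf|exact: cg]. Qed.

Lemma min_cont f g : continuous f -> continuous g ->
  continuous (fun x => Num.min (f x) (g x)).
Proof. by move=> cf cg x; apply: continuous_min; [exact: cf|exact: cg]. Qed.

Lemma sum_cont (I : Type) (r : seq I) (P : pred I) (F : I -> X -> R) :
  (forall i, P i -> continuous (F i)) ->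
  continuous (fun x => \sum_(i <- r | P i) F i x).
Proof.
move=> cF; elim: r => [|i r IH].
  rewrite (_ : (fun x => _) = fun=> 0); first exact: cst_cont.
  by apply/funext => x; rewrite big_nil.
rewrite (_ : (fun x => _) = fun x => (if P i then F i x else 0) +
    \sum_(j <- r | P j) F j x); last first.
  by apply/funext => x; rewrite big_cons; case: ifP; rewrite ?add0r.
by apply: add_cont => //; case: (boolP (P i)) => [/cF//|_]; exact: cst_cont.
Qed.

Lemma prod_cont (I : Type) (r : seq I) (P : pred I) (F : I -> X -> R) :
  (forall i, P i -> continuous (F i)) ->
  continuous (fun x => \prod_(i <- r | P i) F i x).
Proof.
move=> cF; elim: r => [|i r IH].
  rewrite (_ : (fun x => _) = fun=> 1); first exact: cst_cont.
  by apply/funext => x; rewrite big_nil.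
rewrite (_ : (fun x => _) = fun x => (if P i then F i x else 1) *
    \prod_(j <- r | P j) F j x); last first.
  by apply/funext => x; rewrite big_cons; case: ifP; rewrite ?mul1r.
by apply: mul_cont => //; case: (boolP (P i)) => [/cF//|_]; exact: cst_cont.
Qed.

End real_valued_maps.

Lemma set_val_continuous {X : topologicalType} (S : set X) :
  continuous (set_val : set_type S -> X).
Proof. exact: (@initial_continuous _ _ (@set_val _ S)). Qed.

Lemma into_set_type_continuous {W X : topologicalType} (S : set X)
  (f : W -> set_type S) : continuous (set_val \o f) -> continuous f.
Proof. exact: continuous_comp_initial. Qed.

Lemma continuous_ptws (W : topologicalType) (I : eqType) (K : topologicalType)
  (f : W -> {ptws I -> K}) :
  (forall i, continuous (fun w => f w i)) -> continuous f.
Proof.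
move=> cf w; apply/cvg_sup => i.
have : continuous (f : W -> initial_topology (@^~ i)).
  by apply: continuous_comp_initial; exact: cf.
by apply.
Qed.

Lemma pair_continuous {W X Y : topologicalType} (f : W -> X) (g : W -> Y) :
  continuous f -> continuous g -> continuous (fun w => (f w, g w)).
Proof.
by move=> cf cg w; apply: (@cvg_pair _ _ _ _ (nbhs (f w)) (nbhs (g w)));
  [exact: cf|exact: cg].
Qed.

Lemma comp_continuous {W X Y : topologicalType} (f : W -> X) (g : X -> Y) :
  continuous f -> continuous g -> continuous (g \o f).
Proof. by move=> cf cg w; apply: continuous_comp; [exact: cf|exact: cg]. Qed.

Lemma fst_continuous {W X : topologicalType} : continuous (@fst W X).
Proof. by move=> w; exact: cvg_fst. Qed.

Lemma snd_continuous {W X : topologicalType} : continuous (@snd W X).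
Proof. by move=> w; exact: cvg_snd. Qed.

(** The closed sets where [c] is at most 0 and at least 0 cover [W], and the two maps agree on their
    intersection. *)
Lemma pasting {R : realType} {W X : topologicalType} (c : W -> R)
    (f g : W -> X) :
  continuous c -> continuous f -> continuous g ->
  (forall w, c w = 0 -> f w = g w) ->
  continuous (fun w => if c w <= 0 then f w else g w).
Proof.
move=> cc cf cg fg; set h := (X in continuous X).
have hf : {in [set w | c w <= 0], f =1 h}.
  by move=> w; rewrite inE /h /= => ->.
have hg : {in [set w | 0 <= c w], g =1 h}.
  move=> w; rewrite inE /h /= => cw; case: ifP => // cw'.
  by apply/esym/fg/le_anti; rewrite cw cw'.
have : {within [set w | c w <= 0] `|` [set w | 0 <= c w], continuous h}.
  apply: withinU_continuous.
  - apply: (@closed_comp _ _ c [set u | u <= 0]); last exact: closed_le.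
    by move=> w _; exact: cc.
  - apply: (@closed_comp _ _ c [set u | 0 <= u]); last exact: closed_ge.
    by move=> w _; exact: cc.
  - by apply: (subspace_eq_continuous hf); apply: continuous_subspaceT.
  - by apply: (subspace_eq_continuous hg); apply: continuous_subspaceT.
rewrite (_ : _ `|` _ = setT).
  by move=> H; apply/continuous_subspace_setT.
by apply/seteqP; split => // w _ /=; apply/orP; exact: le_total.
Qed.

(** * Homotopies relative to a subset and deformation retracts *)

Section homotopies.
Context {R : realType}.
Implicit Types W X Y Z : topologicalType.

Fact clamp_subproof (u : R) :
  Num.max 0 (Num.min 1 u) \in [set t : R | 0 <= t <= 1].
Proof.
rewrite inE /= le_max lexx/= ge_max ler01/=.
by rewrite ge_min lexx.
Qed.

(** The retraction of the line onto the unit interval: rescaled times can be fed to a homotopy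
    without carrying proofs of bounds. *)
Definition clamp (u : R) : I01 R := SigSub (clamp_subproof u).

Lemma val_clampE (u : R) : set_val (clamp u) = Num.max 0 (Num.min 1 u).
Proof. by []. Qed.

Lemma clamp_continuous : continuous clamp.
Proof.
apply: into_set_type_continuous.
apply: max_cont; first exact: cst_cont.
by apply: min_cont; [exact: cst_cont|move=> x; exact: cvg_id].
Qed.

Lemma I01_bounds (t : I01 R) : 0 <= (set_val t : R) <= 1.
Proof. exact: (set_valP t). Qed.

Lemma clamp_le0 (u : R) : u <= 0 -> clamp u = I0.
Proof.
move=> u0; apply/val_inj; rewrite [LHS]val_clampE [RHS]/=.
by rewrite (min_r (le_trans u0 ler01)) (max_l u0).
Qed.

Lemma clamp_ge1 (u : R) : 1 <= u -> clamp u = I1.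
Proof.
by move=> u1; apply/val_inj; rewrite [LHS]val_clampE (min_l u1) max_r.
Qed.

Lemma time_continuous X (h : R -> R) : continuous h ->
  continuous (fun p : X * I01 R => (p.1, clamp (h (set_val p.2)))).
Proof.
move=> ch; apply: pair_continuous; first exact: fst_continuous.
apply: comp_continuous clamp_continuous; apply: comp_continuous ch.
exact: comp_continuous snd_continuous (@set_val_continuous _ _).
Qed.

Lemma homotopic_rel_trans X Y (A : set X) (f g h : X -> Y) :
  homotopic_rel (R := R) A f g -> homotopic_rel (R := R) A g h ->
  homotopic_rel (R := R) A f h.
Proof.
move=> [H [cH H0 H1 HA]] [K [cK K0 K1 KA]].
have idc : continuous (fun u : R => u) by move=> x; exact: cvg_id.
(* The two homotopies run at double speed and are glued at time 1/2. *)
exists (fun p => if 2 * set_val p.2 - 1 <= 0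
  then H (p.1, clamp (2 * set_val p.2))
  else K (p.1, clamp (2 * set_val p.2 - 1))); split.
- apply: pasting.
  + apply: sub_cont; last exact: cst_cont.
    apply: mul_cont; first exact: cst_cont.
    exact: comp_continuous snd_continuous (@set_val_continuous _ _).
  + exact: comp_continuous (@time_continuous X (fun u => 2 * u)
      (mul_cont (@cst_cont R R 2) idc)) cH.
  + exact: comp_continuous (@time_continuous X (fun u => 2 * u - 1)
      (sub_cont (mul_cont (@cst_cont R R 2) idc) (@cst_cont R R 1))) cK.
  + move=> [x t] /= t0; rewrite t0 (@clamp_le0 0)// clamp_ge1 ?H1 ?K0//.
    by move: t0 => /eqP; rewrite subr_eq0 => /eqP ->.
- by move=> x /=; rewrite mulr0 sub0r oppr_le0 ler01 clamp_le0.
- move=> x /=; rewrite mulr1 ifF; last by apply/negbTE; rewrite -ltNge; lra.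
  by rewrite clamp_ge1 ?K1//; lra.
- move=> x t Ax /=; case: ifP => _; first exact: HA.
  (* On [A] the second half rests at [g x], which is the end of the first half and hence equals
     [f x]. *)
  by rewrite KA// -H1 HA.
Qed.

Lemma homotopic_relS X Y (A B : set X) (f g : X -> Y) : B `<=` A ->
  homotopic_rel (R := R) A f g -> homotopic_rel (R := R) B f g.
Proof.
by move=> BA [H [cH H0 H1 HA]]; exists H; split => // x t /BA; exact: HA.
Qed.

Lemma homotopic_rel_precomp W X Y (B : set W) (A : set X) (f g : X -> Y)
    (a : W -> X) : continuous a -> (forall w, B w -> A (a w)) ->
  homotopic_rel (R := R) A f g -> homotopic_rel (R := R) B (f \o a) (g \o a).
Proof.
move=> ca BA [H [cH H0 H1 HA]].
exists (fun p => H (a p.1, p.2)); split => //=.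
- apply: comp_continuous cH; apply: pair_continuous; last exact: snd_continuous.
  exact: comp_continuous fst_continuous ca.
- by move=> w t Bw; rewrite HA//; exact: BA.
Qed.

Lemma homotopic_rel_postcomp X Y Z (A : set X) (f g : X -> Y) (h : Y -> Z) :
  continuous h ->
  homotopic_rel (R := R) A f g -> homotopic_rel (R := R) A (h \o f) (h \o g).
Proof.
move=> ch [H [cH H0 H1 HA]]; exists (h \o H); split => /=.
- exact: comp_continuous cH ch.
- by move=> x; rewrite H0.
- by move=> x; rewrite H1.
- by move=> x t Ax; rewrite HA.
Qed.

Lemma homotopic_joined X Y (f g : X -> Y) (x : X) :
  homotopic (R := R) f g -> joined_by_path (R := R) (f x) (g x).
Proof.
move=> [H [cH H0 H1 _]]; exists (fun t => H (x, t)); split => //.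
apply: comp_continuous cH.
by apply: pair_continuous; [exact: cst_continuous|move=> t; exact: cvg_id].
Qed.

Lemma joined_map X Y (f : X -> Y) (x y : X) : continuous f ->
  joined_by_path (R := R) x y -> joined_by_path (R := R) (f x) (f y).
Proof.
move=> cf [p [cp <- <-]]; exists (f \o p); split => //.
exact: comp_continuous cp cf.
Qed.

(** Composing with [g] undoes [f], which gives injectivity on homotopy classes; [g \o b] is a
    preimage of [b] up to homotopy. The homotopy rests on the range of [f], which contains the base
    point [f x], so it is relative to the boundary of the cube. *)
Lemma deformation_retract_whe X Y (f : X -> Y) (g : Y -> X) :
  continuous f -> continuous g -> cancel f g ->
  homotopic_rel (R := R) (range f) (f \o g) idfun ->
  weak_homotopy_equivalence R f.
Proof.
move=> cf cg fK fg.
have jfg y : joined_by_path (R := R) (f (g y)) y.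
  have [H [cH H0 H1 _]] := fg; apply: (@homotopic_joined _ _ (f \o g) idfun y).
  by exists H; split.
split => //.
  split => [x x' /(joined_map cg)|y]; first by rewrite !fK; apply.
  by exists (g y).
move=> n x _; split => [a a' [ca ax] [ca' ax'] h|b [cb bx]].
  have := homotopic_rel_postcomp cg h.
  by congr homotopic_rel; apply/funext => t /=; rewrite fK.
exists (g \o b); last first.
  apply: (homotopic_rel_precomp cb _ fg).
  by move=> t /bx ->; exists x.
by split => [|t /bx /= ->]; [exact: comp_continuous cb cg|exact: fK].
Qed.

End homotopies.

(** * Maps between geometric realizations *)

Section realization_maps.
Context {R : realType} (C : finType) (T : complex C).
Local Notation real := (@realization C R T).
Implicit Types (h : C -> R) (b : real).

Definition supp h : {set C} := [set c | h c != 0]%SET.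

Lemma in_supp h c : (c \in supp h) = (h c != 0).
Proof. by rewrite inE. Qed.

Lemma coord_ge0 b c : 0 <= set_val b c :> R.
Proof. by have [/(_ c)] := set_valP b. Qed.

Lemma sum_coord b : \sum_c set_val b c = 1 :> R.
Proof. by have [] := set_valP b. Qed.

Lemma supp_simplex b : supp (set_val b) \in T.
Proof. by have [_ _] := set_valP b. Qed.

Lemma bary_continuous c : continuous (fun b => set_val b c : R).
Proof.
exact: comp_continuous (@set_val_continuous _ (@realization_set C R T))
  (@proj_continuous C (fun=> R) c).
Qed.

Lemma into_realization_continuous (W : topologicalType) (f : W -> real) :
  (forall c, continuous (fun w => set_val (f w) c : R)) -> continuous f.
Proof.
by move=> cf; apply: into_set_type_continuous; exact: continuous_ptws.
Qed.

Lemma realizationP b b' : (forall c, set_val b c = set_val b' c :> R) -> b = b'.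
Proof. by move=> bb'; apply/val_inj/funext. Qed.

Lemma sum_gt0 h : (forall c, 0 <= h c) -> supp h != finset.set0 ->
  0 < \sum_c h c.
Proof.
move=> h0 /set0Pn[c]; rewrite in_supp => hc.
rewrite (bigD1 c)//= ltr_pwDl ?lt0r ?hc ?h0//.
by apply: sumr_ge0 => c' _.
Qed.

Lemma supp_neq0 h : \sum_c h c != 0 -> supp h != finset.set0.
Proof.
apply: contraNneq => h0; apply/eqP/big1 => c _.
by apply/eqP; rewrite -[_ == _]negbK -in_supp h0 inE.
Qed.

Lemma simplex_neq0 s : s \in T -> s != finset.set0.
Proof. by apply: contraTneq => ->; exact: complex_set0. Qed.

Lemma normalized_map (W : topologicalType) (h : W -> C -> R) :
  (forall w c, 0 <= h w c) -> (forall w, supp (h w) \in T) ->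
  (forall c, continuous (h ^~ c)) ->
  exists2 f : W -> real, continuous f &
    forall w c, set_val (f w) c = h w c / \sum_c' h w c' :> R.
Proof.
move=> h0 hT ch.
have s0 w : 0 < \sum_c h w c.
  by apply: sum_gt0 => //; exact: (simplex_neq0 (hT w)).
have hP w : (fun c => h w c / \sum_c' h w c') \in @realization_set C R T.
  apply/mem_set; split.
  - by move=> c; rewrite divr_ge0// ltW.
  - by rewrite -mulr_suml divff// gt_eqF.
  - rewrite (_ : [set _ | _]%SET = supp (h w))//; apply/setP => c.
    by rewrite !inE mulf_eq0 invr_eq0 (gt_eqF (s0 w)) orbF.
exists (fun w => SigSub (hP w)) => //.
apply: into_realization_continuous => c /=; apply: div_cont => //.
  by move=> w; rewrite gt_eqF.
exact: sum_cont.
Qed.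

(** Points of the segment from [f w] to [g w] have their support in the union of the two supports,
    and the segment is constant where the maps agree. *)
Lemma linear_homotopy (W : topologicalType) (f g : W -> real) :
  continuous f -> continuous g ->
  (forall w, supp (set_val (f w)) :|: supp (set_val (g w)) \in T) ->
  homotopic_rel (R := R) [set w | f w = g w] f g.
Proof.
move=> cf cg fgT.
pose h (p : W * I01 R) c : R :=
  (1 - set_val p.2) * set_val (f p.1) c + set_val p.2 * set_val (g p.1) c.
have sum1 p : \sum_c h p c = 1.
  by rewrite big_split/= -!mulr_sumr !sum_coord !mulr1 subrK.
have h0 p c : 0 <= h p c.
  have /andP[t0 t1] := I01_bounds p.2.
  by rewrite addr_ge0// mulr_ge0 ?subr_ge0 ?coord_ge0.
have [||c|H cH HE] := @normalized_map _ h => //.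
- move=> p; apply: (complex_sub (fgT p.1)); last first.
    by apply: supp_neq0; rewrite sum1 oner_neq0.
  apply/fintype.subsetP => c; rewrite finset.in_setU !in_supp -negb_and.
  by apply: contraNN => /andP[/eqP f0 /eqP g0]; rewrite /h f0 g0 !mulr0 addr0.
- have c2 : continuous (fun p : W * I01 R => set_val p.2 : R).
    exact: comp_continuous snd_continuous (@set_val_continuous _ _).
  apply: add_cont; apply: mul_cont => //.
  + by apply: sub_cont => //; exact: cst_cont.
  + exact: comp_continuous (comp_continuous fst_continuous cf)
      (@bary_continuous c).
  + exact: comp_continuous (comp_continuous fst_continuous cg)
      (@bary_continuous c).
exists H; split => //.
- move=> w; apply: realizationP => c.
  by rewrite HE sum1 divr1 /h /= subr0 mul1r mul0r addr0.
- move=> w; apply: realizationP => c.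
  by rewrite HE sum1 divr1 /h /= subrr mul1r mul0r add0r.
- move=> w t /= fg; apply: realizationP => c.
  by rewrite HE sum1 divr1 /h /= -fg -mulrDl subrK mul1r.
Qed.

End realization_maps.

(** * Full subcomplexes and extension of coordinates by zero *)

Section pushforward_of_coordinates.
Context {R : realType} (A C : finType) (i : A -> C) (i_inj : injective i).
Variables (K : complex A) (T : complex C).
Hypothesis KT : forall s : {set A}, (s \in K) = (i @: s \in T).
Local Notation realK := (@realization A R K).
Local Notation realT := (@realization C R T).

(** For injective [i] at most one term occurs, so this is extension by zero; written as a sum, it is
    visibly continuous in [b]. *)
Definition push_coord (b : A -> R) (c : C) : R := \sum_(a | i a == c) b a.

Lemma push_coord_im b a : push_coord b (i a) = b a.
Proof.
rewrite /push_coord (bigD1 a)//= big1 ?addr0// => a' /andP[/eqP/i_inj ->].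
by rewrite eqxx.
Qed.

Lemma push_coord_out b c : c \notin codom i -> push_coord b c = 0.
Proof.
move=> ci; rewrite /push_coord big_pred0// => a.
by apply: contraNF ci => /eqP <-; exact: codom_f.
Qed.

Lemma supp_push_coord b : supp (push_coord b) = i @: supp b.
Proof.
apply/setP => c; rewrite in_supp; have [|ci] := boolP (c \in codom i).
  by move=> /codomP[a ->]; rewrite push_coord_im mem_imset// in_supp.
rewrite push_coord_out// eqxx; apply/esym/negbTE; apply: contra ci.
by move=> /imsetP[a _ ->]; exact: codom_f.
Qed.

Lemma sum_push_coord b : \sum_c push_coord b c = \sum_a b a.
Proof.
rewrite /push_coord (exchange_big_dep xpredT)//=.
by apply: eq_bigr => a _; rewrite (big_pred1 (i a))// => c; rewrite eq_sym.
Qed.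

Fact push_subproof (b : realK) :
  push_coord (set_val b) \in @realization_set C R T.
Proof.
apply/mem_set; split.
- by move=> c; apply: sumr_ge0 => a _; exact: coord_ge0.
- by rewrite sum_push_coord sum_coord.
- rewrite -[X in X \in _]/(supp _) supp_push_coord -KT; exact: supp_simplex.
Qed.

Definition push (b : realK) : realT := SigSub (push_subproof b).

Lemma val_push b : set_val (push b) = push_coord (set_val b).
Proof. by []. Qed.

Lemma push_continuous : continuous push.
Proof.
apply: into_realization_continuous => c; apply: sum_cont => a _.
exact: bary_continuous.
Qed.

End pushforward_of_coordinates.

(** * Deformation of a complex onto a full subcomplex *)

Section push_equivalence.
Context {R : realType} (A C : finType) (i : A -> C) (i_inj : injective i).
Variables (K : complex A) (T : complex C).
Hypothesis KT : forall s : {set A}, (s \in K) = (i @: s \in T).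
Local Notation realK := (@realization A R K).
Local Notation realT := (@realization C R T).

Local Notation outer s := (s :\: [set c in codom i]%SET).

(** In the application, [e t] is a point related to all outer vertices of [t]. If [t] contains the
    outer part of [s], then [e t] is related to that part too, so such points can be added to [s]
    all at once. *)
Variable e : {set C} -> A.
Hypothesis eT : forall s, s \in T -> outer s != finset.set0 ->
  forall Q : {set {set C}},
    (forall t, t \in Q ->
      [/\ t \in T, t \subset [predC codom i] & outer s \subset t]) ->
    s :|: [set i (e t) | t in Q]%SET \in T.

(** Being less than the average of the coordinates, [eps] is exceeded by one of them, so truncation
    at [eps] never kills a point. *)
Let eps : R := (#|C|.+1)%:R^-1.

Let eps_gt0 : 0 < eps. Proof. by rewrite invr_gt0 ltr0n. Qed.

Let exists_gt_eps (b : realT) : exists c, eps < set_val b c.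
Proof.
apply/existsP; apply: contraT => /existsPn small.
have : \sum_c (set_val b c : R) <= \sum_(c : C) eps.
  by apply: ler_sum => c _; rewrite leNgt; exact: small.
rewrite sum_coord sumr_const -mulr_natl ler_pdivlMr ?ltr0n// mul1r ler_nat.
by rewrite ltnn.
Qed.

(* The vertices c outside of the image of i that survive this truncation are
   those of every t with weight t b != 0; this is why b is deformed to the
   normalization of trunc b before it is joined linearly to retr b. *)
Let trunc (b : realT) (c : C) : R :=
  if c \in codom i then set_val b c else Num.max 0 (set_val b c - eps).

(* A product that is non-zero only for the t between {c | b c >= eps} and
   {c | b c > 0} (outside of the image of i), hence only for simplices t, and
   that is non-zero for the largest of them. *)
Let weight (t : {set C}) (b : realT) : R := \prod_(c | c \notin codom i)
  if c \in t then set_val b c else Num.max 0 (eps - set_val b c).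

Let total (b : realT) : R :=
  \sum_(c | c \notin codom i) Num.max 0 (set_val b c - eps).

(* The factor total b makes retr the identity on the image of i. *)
Let retr (b : realT) (a : A) : R := set_val b (i a) +
  total b * \sum_(t : {set C} | (t \subset [predC codom i]) && (e t == a))
    weight t b.

Let trunc_ge0 b c : 0 <= trunc b c.
Proof. by rewrite /trunc; case: ifP; rewrite ?coord_ge0// le_max lexx. Qed.

Let weight_ge0 t b : 0 <= weight t b.
Proof.
apply: prodr_ge0 => c _.
by case: ifP; rewrite ?coord_ge0// le_max lexx.
Qed.

Let total_ge0 b : 0 <= total b.
Proof. by apply: sumr_ge0 => c _; rewrite le_max lexx. Qed.

Let retr_ge0 b a : 0 <= retr b a.
Proof.
rewrite addr_ge0 ?coord_ge0// mulr_ge0 ?total_ge0//.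
by apply: sumr_ge0 => t _; exact: weight_ge0.
Qed.

Let max0_neq0 (u : R) : (Num.max 0 u != 0) = (0 < u).
Proof. by case: ltP => [/gt_eqF ->//|_]; rewrite eqxx. Qed.

Let coord_neq0 (b : realT) c :
  (set_val b c != 0 :> R) = (0 < (set_val b c : R)).
Proof. by rewrite lt0r coord_ge0 andbT. Qed.

Let supp_trunc b : supp (trunc b) \subset supp (set_val b).
Proof.
apply/fintype.subsetP => c; rewrite !in_supp /trunc; case: ifP => // _.
by rewrite max0_neq0 subr_gt0 coord_neq0; exact: lt_trans.
Qed.

Let supp_trunc_neq0 b : supp (trunc b) != finset.set0.
Proof.
have [c bc] := exists_gt_eps b; apply/set0Pn; exists c.
rewrite in_supp /trunc; case: ifP => _.
  by rewrite coord_neq0 (lt_trans eps_gt0).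
by rewrite max0_neq0 subr_gt0.
Qed.

Let supp_trunc_simplex b : supp (trunc b) \in T.
Proof.
exact: complex_sub (supp_simplex b) (supp_trunc b) (supp_trunc_neq0 b).
Qed.

Let total_neq0 b : (total b != 0) = (outer (supp (trunc b)) != finset.set0).
Proof.
rewrite /total psumr_neq0; last by move=> c _; rewrite le_max lexx.
apply/hasP/set0Pn => [[c _ /andP[ci bc]]|[c]].
  exists c; rewrite finset.in_setD inE ci in_supp /trunc (negbTE ci).
  by rewrite gt_eqF.
rewrite finset.in_setD inE in_supp /trunc => /andP[ci]; rewrite (negbTE ci).
move=> bc; exists c; rewrite ?mem_index_enum//= ci lt0r bc.
by rewrite le_max lexx.
Qed.

Let weight_neq0 t b : weight t b != 0 ->
  t \subset [predC codom i] ->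
  outer (supp (trunc b)) \subset t /\ t \subset supp (set_val b).
Proof.
move=> /prodf_neq0 w ti; split; apply/fintype.subsetP => c.
  rewrite finset.in_setD inE in_supp /trunc => /andP[ci]; rewrite (negbTE ci).
  rewrite max0_neq0 subr_gt0 => bc; have := w _ ci; case: ifP => // _.
  by rewrite max0_neq0 subr_gt0 ltNge ltW.
move=> ct; rewrite in_supp; have ci := fintype.subsetP ti _ ct.
by have := w _ ci; rewrite ct.
Qed.

Let weight_supp b : weight (outer (supp (set_val b))) b != 0.
Proof.
apply/prodf_neq0 => c ci; rewrite finset.in_setD inE ci in_supp /=.
case: ifP => // /negbFE/eqP ->.
by rewrite subr0 max0_neq0.
Qed.

(** One simplex [U] serves twice: it shows that the support of [retr b] is a simplex of [K], and
    that the segment from the truncated point to the retracted one stays in [T]. *)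
Let retr_simplex b : exists2 U, U \in T &
  supp (trunc b) \subset U /\ i @: supp (retr b) \subset U.
Proof.
pose Q := [set t : {set C} | [&& t \subset [predC codom i],
  weight t b != 0 & total b != 0]]%SET.
exists (supp (trunc b) :|: [set i (e t) | t in Q]%SET).
  (* If [total b] vanishes, [Q] is empty and [U] is the truncated support. Otherwise every [t] in
     [Q] lies between the outer parts of the truncated and the full support, as the hypothesis on
     [e] requires. *)
  have [tb|tb] := boolP (total b == 0).
    rewrite (_ : [set _ | _ in _]%SET = finset.set0) ?finset.setU0//.
    apply/setP => c; rewrite !inE; apply/negbTE/imsetP => -[t].
    by rewrite inE tb !andbF.
  apply: eT => //; first by rewrite -total_neq0.
  move=> t; rewrite inE => /and3P[ti wt _].
  have [outer_t t_supp] := weight_neq0 wt ti.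
  split => //; apply: (complex_sub (supp_simplex b) t_supp).
  rewrite total_neq0 in tb; case/set0Pn: tb => c co.
  by apply/set0Pn; exists c; exact: (fintype.subsetP outer_t).
split; first exact: finset.subsetUl.
apply/fintype.subsetP => _ /imsetP[a + ->]; rewrite in_supp finset.in_setU.
have [/eqP ba|ba] := boolP (set_val b (i a) == 0 :> R); last first.
  by move=> _; rewrite in_supp /trunc codom_f ba.
rewrite /retr ba add0r mulf_eq0 negb_or => /andP[tb].
rewrite psumr_neq0; last by move=> t _; exact: weight_ge0.
move=> /hasP[t _ /andP[/andP[ti /eqP <-] wt]].
by apply/orP; right; apply/imsetP; exists t => //; rewrite inE ti tb gt_eqF.
Qed.

Let supp_retr_neq0 b : supp (retr b) != finset.set0.
Proof.
(* If [total b] vanishes, a vertex that survives truncation lies in the image of [i] and keeps its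
   coordinate. Otherwise the term of the whole outer support of [b] is positive. *)
have [tb|tb] := boolP (total b == 0).
  have /set0Pn[c bc] := supp_trunc_neq0 b.
  have /codomP[a ca] : c \in codom i.
    apply: contraTT tb => ci; rewrite total_neq0; apply/set0Pn; exists c.
    by rewrite finset.in_setD inE ci.
  apply/set0Pn; exists a; rewrite in_supp /retr (eqP tb) mul0r addr0 -ca.
  by have := fintype.subsetP (supp_trunc b) _ bc; rewrite in_supp.
set t := outer (supp (set_val b)).
apply/set0Pn; exists (e t); rewrite in_supp gt_eqF// /retr.
rewrite ltr_wpDl ?coord_ge0// mulr_gt0//.
  by rewrite lt0r tb total_ge0.
rewrite (bigD1 t)/=; last first.
  rewrite eqxx andbT; apply/fintype.subsetP => c.
  by rewrite finset.in_setD !inE => /andP[].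
rewrite ltr_pwDl//; first by rewrite lt0r weight_supp weight_ge0.
by apply: sumr_ge0 => t' _; exact: weight_ge0.
Qed.

Let trunc_continuous c : continuous (trunc ^~ c).
Proof.
rewrite /trunc; case: (c \in codom i).  exact: bary_continuous.
apply: max_cont; first exact: cst_cont.
by apply: sub_cont; [exact: bary_continuous|exact: cst_cont].
Qed.

Let retr_continuous a : continuous (retr ^~ a).
Proof.
apply: add_cont; first exact: bary_continuous.
apply: mul_cont; apply: sum_cont.
  move=> c _; apply: max_cont; first exact: cst_cont.
  by apply: sub_cont; [exact: bary_continuous|exact: cst_cont].
move=> t _; apply: prod_cont => c _; case: (c \in t).
  exact: bary_continuous.
apply: max_cont; first exact: cst_cont.
by apply: sub_cont; [exact: cst_cont|exact: bary_continuous].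
Qed.

(** With [f] and [g] the normalizations of [trunc] and [retr], the map [g] followed by [push] is
    deformed linearly to [f], inside the simplex of [retr_simplex], and [f] linearly to the
    identity, since truncation shrinks supports. Both deformations rest on the range of [push],
    where there are no outer coordinates to truncate. *)
Lemma push_whe : weak_homotopy_equivalence R (@push R A C i i_inj K T KT).
Proof.
have [f cf fE] := normalized_map trunc_ge0 supp_trunc_simplex trunc_continuous.
have supp_retr_simplex b : supp (retr b) \in K.
  have [U UT [_ retrU]] := retr_simplex b.
  rewrite KT; apply: (complex_sub UT retrU).
  by rewrite finset.imset_eq0 supp_retr_neq0.
have [g cg gE] := normalized_map retr_ge0 supp_retr_simplex retr_continuous.
have cp := @push_continuous R A C i i_inj K T KT.
have total_push b : total (push i_inj KT b) = 0.
  apply: big1 => c ci; rewrite val_push push_coord_out// sub0r.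
  by rewrite max_l// oppr_le0 ltW.
have retr_push b a : retr (push i_inj KT b) a = set_val b a.
  by rewrite /retr total_push mul0r addr0 val_push push_coord_im.
have trunc_push b c : trunc (push i_inj KT b) c = set_val (push i_inj KT b) c.
  rewrite /trunc val_push; case: ifPn => // ci.
  by rewrite push_coord_out// sub0r max_l// oppr_le0 ltW.
have gK : cancel (push i_inj KT) g.
  move=> b; apply: realizationP => a.
  rewrite gE retr_push (eq_bigr _ (fun a _ => retr_push b a)).
  by rewrite sum_coord divr1.
have fp b : f (push i_inj KT b) = push i_inj KT b.
  apply: realizationP => c.
  rewrite fE trunc_push (eq_bigr _ (fun c _ => trunc_push b c)).
  by rewrite sum_coord divr1.
have supp_normalize (B : finType) (h h' : B -> R) :
    (forall c, h c = h' c / \sum_c' h' c') -> supp h \subset supp h'.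
  move=> hE; apply/fintype.subsetP => c; rewrite !in_supp hE.
  by apply: contraNneq => ->; rewrite mul0r.
have suppf b := supp_normalize _ _ _ (fE b).
have suppg b := supp_normalize _ _ _ (gE b).
have suppU_simplex b b' U : U \in T -> supp (set_val b) \subset U ->
    supp (set_val b') \subset U ->
    supp (set_val (b : realT)) :|: supp (set_val (b' : realT)) \in T.
  move=> UT bU b'U; apply: (complex_sub UT); first by rewrite finset.subUset bU.
  have /set0Pn[c cb] := simplex_neq0 (supp_simplex b).
  by apply/set0Pn; exists c; rewrite finset.in_setU cb.
apply: (deformation_retract_whe cp cg gK).
apply: (@homotopic_rel_trans _ _ _ _ _ f).
  apply: homotopic_relS; last first.
    apply: linear_homotopy => //; first exact: comp_continuous cg cp.
    move=> b; have [U UT [truncU retrU]] := retr_simplex b.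
    apply: (suppU_simplex _ _ _ UT) => /=.
      rewrite val_push supp_push_coord//.
      by apply: fintype.subset_trans retrU; exact: finset.imsetS.
    exact: fintype.subset_trans truncU.
  by move=> _ [b _ <-] /=; rewrite gK fp.
apply: homotopic_relS; last first.
  apply: linear_homotopy => //; first by move=> b; exact: cvg_id.
  move=> b; apply: (suppU_simplex _ _ _ (supp_simplex b)) => //.
  exact: fintype.subset_trans (supp_trunc b).
by move=> _ [b _ <-] /=; rewrite fp.
Qed.

End push_equivalence.

(** * Dowker duality *)

Definition dowker_simplex (A B : finType) (r : A -> B -> Prop) (s : {set A}) :=
  s != finset.set0 /\ exists w, forall y, y \in s -> r y w.

Section dowker_complex.
Variables (A B : finType) (r : A -> B -> Prop).

Definition dowker_simplices : {set {set A}} :=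
  [set s | `[< dowker_simplex r s >]]%SET.

Fact dowker_set0 : finset.set0 \notin dowker_simplices.
Proof. by rewrite finset.in_set; apply/asboolP => -[]; rewrite eqxx. Qed.

Fact dowker_sub (s t : {set A}) : s \in dowker_simplices ->
  t \subset s -> t != finset.set0 -> t \in dowker_simplices.
Proof.
rewrite !finset.in_set => /asboolP[_ [w sw]] /fintype.subsetP ts t0.
apply/asboolP; split => //.
by exists w => y /ts; exact: sw.
Qed.

Definition dowker : complex A := Complex dowker_set0 dowker_sub.

End dowker_complex.

Lemma dowkerP (A B : finType) (r : A -> B -> Prop) s :
  s \in dowker r <-> dowker_simplex r s.
Proof. by rewrite finset.in_set; split => /asboolP. Qed.

(** The existential clauses matter when [s] lies on one side, where the last clause is vacuous; they
    follow from it when [s] meets both sides. Arbitrary maps [i] and [j] allow the sides to be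
    exchanged. *)
Definition join_simplex (A B C : finType) (i : A -> C) (j : B -> C)
    (r : A -> B -> Prop) (s : {set C}) :=
  [/\ s != finset.set0,
      exists w, forall y, i y \in s -> r y w,
      exists y, forall w, j w \in s -> r y w
    & forall y w, i y \in s -> j w \in s -> r y w].

Lemma join_simplexC (A B C : finType) (i : A -> C) (j : B -> C)
    (r : A -> B -> Prop) (s : {set C}) :
  join_simplex i j r s <-> join_simplex j i (fun w y => r y w) s.
Proof. by split => -[s0 [w sw] [y sy] sr]; split; eauto. Qed.

Section join_complex.
Variables (A B : finType) (r : A -> B -> Prop).

Definition join_simplices : {set {set A + B}} :=
  [set s | `[< join_simplex inl inr r s >]]%SET.

Fact join_set0 : finset.set0 \notin join_simplices.
Proof. by rewrite finset.in_set; apply/asboolP => -[]; rewrite eqxx. Qed.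

Fact join_sub (s t : {set A + B}) : s \in join_simplices ->
  t \subset s -> t != finset.set0 -> t \in join_simplices.
Proof.
rewrite !finset.in_set => /asboolP[_ [w sw] [y sy] sr] /fintype.subsetP ts t0.
apply/asboolP; split => //.
- by exists w => y' /ts; exact: sw.
- by exists y => w' /ts; exact: sy.
- by move=> y' w' /ts ? /ts; exact: sr.
Qed.

Definition join : complex (A + B)%type := Complex join_set0 join_sub.

End join_complex.

Lemma joinP (A B : finType) (r : A -> B -> Prop) s :
  s \in join r <-> join_simplex inl inr r s.
Proof. by rewrite finset.in_set; split => /asboolP. Qed.

Section one_side.
Context {R : realType} (A B C : finType) (i : A -> C) (j : B -> C).
Variable r : A -> B -> Prop.
Hypotheses (i_inj : injective i)
  (ij : forall c, (c \in codom j) = (c \notin codom i)).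
Variables (K : complex A) (T : complex C).
Hypothesis KP : forall s, s \in K <-> dowker_simplex r s.
Hypothesis TP : forall s, s \in T <-> join_simplex i j r s.

Let j_out w : j w \notin codom i.
Proof. by rewrite -ij codom_f. Qed.

Lemma join_restrict s : (s \in K) = (i @: s \in T).
Proof.
have jim w : (j w \in i @: s) = false.
  apply/negbTE/imsetP => -[y _ jw]; have := j_out w.
  by rewrite jw codom_f.
apply/idP/idP.
  move=> /KP[s0 [w sw]]; apply/TP; split.
  - by rewrite finset.imset_eq0.
  - by exists w => y; rewrite mem_imset//; exact: sw.
  - by case/set0Pn: s0 => y _; exists y => w'; rewrite jim.
  - by move=> y w'; rewrite jim.
move=> /TP[s0 [w sw] _ _]; apply/KP; split.
  by rewrite finset.imset_eq0 in s0.
by exists w => y ys; apply: sw; rewrite mem_imset.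
Qed.

(** The map [e] chooses for each simplex [t] a point related to all its vertices on the side of
    [j]. *)
Lemma join_push_whe :
  weak_homotopy_equivalence R (@push R A C i i_inj K T join_restrict).
Proof.
(* The choice of [e] needs a default value on sets that are not simplices. A point of the
   realization supplies one; if there is none, all claims are vacuous. *)
have [[b0]|T0] := pselect (inhabited (@realization C R T)); last first.
  split; first exact: push_continuous.
    split => [x|y]; exfalso; apply: T0; last exact: (inhabits y).
    exact: (inhabits (push i_inj join_restrict x)).
  move=> n x; exfalso; apply: T0.
  exact: (inhabits (push i_inj join_restrict x)).
have [_ _ [y0 _] _] := (TP _).1 (supp_simplex b0).
have /choice[e eP] : forall t : {set C}, exists y : A,
    t \in T -> forall w, j w \in t -> r y w.
  move=> t; have [tT|tT] := boolP (t \in T); last by exists y0.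
  by have [_ _ [y yt] _] := (TP _).1 tT; exists y.
apply: (@push_whe R A C i i_inj K T join_restrict e) => s sT /set0Pn[c].
rewrite finset.in_setD inE => /andP[ci cs] Q QP.
have [w0 cw0] : exists w0, c = j w0.
  by move: ci; rewrite -ij => /codomP[w0 ->]; exists w0.
have outQ w t : j w \in s -> t \in Q -> j w \in t.
  move=> ws /QP[_ _ /fintype.subsetP]; apply.
  by rewrite finset.in_setD inE j_out.
have jU w : j w \in s :|: [set i (e t) | t in Q]%SET -> j w \in s.
  rewrite finset.in_setU => /orP[//|/imsetP[t _ jw]].
  by have := j_out w; rewrite jw codom_f.
have iU y : i y \in s :|: [set i (e t) | t in Q]%SET ->
    i y \in s \/ exists2 t, t \in Q & y = e t.
  rewrite finset.in_setU => /orP[|/imsetP[t tQ /i_inj ->]]; first by left.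
  by right; exists t.
have [s0 _ [y ys] sr] := (TP _).1 sT.
(* Every [t] in [Q] contains the vertices of [s] on the side of [j], so each added [e t] is related
   to them. *)
have cross y' w' : i y' \in s :|: [set i (e t) | t in Q]%SET ->
    j w' \in s -> r y' w'.
  move=> /iU[y's|[t tQ ->]] w's; first exact: sr.
  by apply: eP; [have [] := QP _ tQ|exact: outQ].
apply/TP; split.
- by apply/set0Pn; exists c; rewrite finset.in_setU cs.
- by exists w0 => y' y'U; apply: cross => //; rewrite -cw0.
- by exists y => w /jU; exact: ys.
- by move=> y' w' y'U /jU; exact: cross.
Qed.

End one_side.

(** * Naturality of Dowker duality *)

Section functorial.
Context {R : realType} (A B : finType) (r : J R -> A -> B -> Prop).
Hypothesis r_homo : forall x y, (x <= y)%O -> forall a b, r x a b -> r y a b.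
Variables (K : J R -> complex A) (D : J R -> complex B).
Hypothesis KS : forall x y, (x <= y)%O -> K x \subset K y.
Hypothesis DS : forall x y, (x <= y)%O -> D x \subset D y.
Hypothesis KP : forall x s, s \in K x <-> dowker_simplex (r x) s.
Hypothesis DP : forall x s, s \in D x <-> dowker_simplex (fun b a => r x a b) s.

Let joinS x y : (x <= y)%O -> join (r x) \subset join (r y).
Proof.
move=> xy; apply/fintype.subsetP => s /joinP[s0 [w sw] [a sa] sr].
apply/joinP; split => //.
- by exists w => a' /sw; exact: r_homo.
- by exists a => w' /sa; exact: r_homo.
- by move=> a' w' a's /(sr _ _ a's); exact: r_homo.
Qed.

Let inr_codom (c : A + B) :
  (c \in codom (@inr A B)) = (c \notin codom (@inl A B)).
Proof.
case: c => c; rewrite codom_f//=; first by apply/negbTE/codomP => -[].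
by apply/esym/codomP => -[].
Qed.

Let inl_codom (c : A + B) :
  (c \in codom (@inl A B)) = (c \notin codom (@inr A B)).
Proof. by rewrite inr_codom negbK. Qed.

Lemma dowker_weakly_equivalent :
  weakly_equivalent R (bifiltration (R := R) KS) (bifiltration DS).
Proof.
have inlI : injective (@inl A B) by move=> ? ? [].
have inrI : injective (@inr A B) by move=> ? ? [].
apply: (rst_trans _ _ _ (bifiltration joinS)).
  apply: rst_step.
  exists (fun x =>
    push inlI (join_restrict inlI inr_codom (KP x) (@joinP _ _ _))).
  split; last by move=> x; exact: join_push_whe.
  (* Inclusions keep coordinates and [push] extends them by zero, independently of the scale, so the
     naturality square commutes on coordinates. *)
  by move=> x y h p; exact/val_inj.
apply/rst_sym/rst_step.
have TP x s : s \in join (r x) <-> join_simplex inr inl (fun b a => r x a b) s.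
  by split=> [/joinP/join_simplexC//|/join_simplexC/joinP].
exists (fun x => push inrI (join_restrict inrI inl_codom (DP x) (TP x))).
split; last by move=> x; exact: join_push_whe.
by move=> x y h p; exact/val_inj.
Qed.

End functorial.
(** * Interleavings of degree complexes *)

Section filtration.
Context {R : realType} d (P : preorderType d) (V : finType).
Variable K : P -> complex V.
Hypothesis KS : forall x y, (x <= y)%O -> K x \subset K y.

Local Notation real x := (@realization V R (K x)).

Fact filtration_id x (h : (x <= x)%O) (b : real x) :
  realization_incl (KS h) b = b.
Proof. exact/val_inj. Qed.

Fact filtration_comp x y z (hxy : (x <= y)%O) (hyz : (y <= z)%O)
    (hxz : (x <= z)%O) (b : real x) :
  realization_incl (KS hxz) b =
  realization_incl (KS hyz) (realization_incl (KS hxy) b).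
Proof. exact/val_inj. Qed.

Definition filtration : functor P :=
  @Functor _ P (fun x => real x) (fun x y h => realization_incl (KS h))
    filtration_id filtration_comp.

(** Both sides have the same spaces and maps; only the proofs of the functor laws could differ. This
    turns the two restrictions of an interleaving into bifiltrations, to which Dowker duality
    applies. *)
Lemma precomp_filtration (f : {omorphism J R -> P}) :
  precomp filtration f =
  bifiltration (K := K \o f) (fun x y h => KS (omorph_le f h)).
Proof.
by rewrite /precomp /bifiltration; congr Functor; exact: Prop_irrelevance.
Qed.

End filtration.

Lemma degree_image (V W : finType) (f : V -> W) (S : complex V) (T : complex W)
    (v : V) : injective f -> (forall s : {set V}, s \in S -> f @: s \in T) ->
  (degree S v <= degree T (f v))%N.
Proof.
move=> f_inj ST; rewrite /degree -(card_imset _ f_inj); apply: subset_leq_card.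
apply/fintype.subsetP => _ /imsetP[w + ->]; rewrite !finset.in_set.
move=> /andP[wv /ST]; rewrite inj_eq// wv/=.
by rewrite finset.imsetU1 finset.imset_set1.
Qed.

(** * Interleaving of the dual complexes *)

Section interleaving.
Context {R : realType} (X Y : finType) (dist : Y -> Y -> R) (i : X -> Y).
Variables (S : R -> complex X) (T : R -> complex Y).
Hypotheses (i_inj : injective i) (dist_xx : forall y, dist y y = 0)
  (dist_sym : forall y z, dist y z = dist z y)
  (dist_triangle : forall x y z, dist x z <= dist x y + dist y z).
Hypotheses (SS : forall r r', r <= r' -> S r \subset S r')
  (TS : forall r r', r <= r' -> T r \subset T r').
Hypothesis ST : forall r (s : {set X}), (s \in S r) = (i @: s \in T r).
Hypothesis T_vertex : forall r y, 0 < r -> [set y]%SET \in T r.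
Hypothesis T_edge : forall r y z, 0 < r -> [set y; z]%SET \in T r ->
  dist y z < 2 * r.

(* w stands for a point at distance less than s from each of its elements,
   which therefore lies in the ball of radius r around y. *)
Definition near_simplex (r : R) (y : Y) (w : {set Y}) :=
  exists s, [/\ 0 < s, w \in T s & exists2 z, z \in w & dist y z + s <= r].

Hypothesis T_near : forall r (w t : {set Y}), t != finset.set0 ->
  (forall y, y \in t -> near_simplex r y w) -> t \in T r.

Section relation.
Variables (V : finType) (f : V -> Y) (U : R -> complex V).
Hypothesis US : forall r r', r <= r' -> U r \subset U r'.
Hypothesis UT : forall r (s : {set V}), (s \in U r) = (f @: s \in T r).

(** Imposing the degree bound on [v] makes the Dowker complex a degree complex. Witnesses are
    subsets of [Y] whatever [V] is, so the duals for [X] and [Y] share their vertex set and can be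
    compared by inclusion. *)
Definition witnesses (x : J R) (v : V) (w : {set Y}) :=
  ((val x).1 : R) * #|V|%:R - 1 <= (degree (U (val x).2) v)%:R /\
  near_simplex (val x).2 (f v) w.

Lemma near_homo r r' y w : r <= r' -> near_simplex r y w -> near_simplex r' y w.
Proof.
move=> rr' [s [s0 wT [z zw yz]]]; exists s; split => //.
by exists z => //; exact: le_trans rr'.
Qed.

Lemma witnesses_homo x y : (x <= y)%O ->
  forall v w, witnesses x v w -> witnesses y v w.
Proof.
move=> /andP[k r] v w [deg vw]; split; last exact: near_homo vw.
apply: (le_trans _ (le_trans deg _)); first by rewrite lerD2r ler_wpM2r.
by rewrite ler_nat; apply/degreeS/US.
Qed.

(** A simplex is its own common witness, with [s] equal to the full scale and each vertex at
    distance 0 from itself. Conversely, [T_near] applies to the common witness. *)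
Lemma ndeg_dowker x s :
  s \in ndeg_complex U x <-> dowker_simplex (witnesses x) s.
Proof.
have r0 : 0 < (val x).2 by have /andP[] := valP x.
rewrite finset.in_set; split.
  move=> /andP[sU /forall_inP deg]; split; first exact: simplex_neq0 sU.
  exists (f @: s) => v vs; split; first exact: deg.
  exists (val x).2; split => //; first by rewrite -UT.
  by exists (f v); rewrite ?imset_f// dist_xx add0r.
move=> [s0 [w sw]]; apply/andP; split.
  rewrite UT; apply: (@T_near _ w); first by rewrite finset.imset_eq0.
  by move=> _ /imsetP[v /sw[_ vw] ->].
by apply/forall_inP => v /sw[].
Qed.

End relation.

Variables (C : R) (hC : 0 < C <= 1) (delta : R) (hdelta : 0 <= delta).
Hypothesis CE : C = #|X|%:R / #|Y|%:R.
Hypothesis X_gt0 : (0 < #|X|)%N.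
Hypothesis measure_le : forall A : {set Y},
  #|A|%:R / #|Y|%:R <=
  #|[set v : X | [exists a in A, dist (i v) a < delta]]%SET|%:R / #|X|%:R
    + delta.

Let wX := witnesses i S.
Let wY := witnesses id T.

Let Y_gt0 : (0 < #|Y|)%N.
Proof. exact: leq_trans X_gt0 (leq_card i i_inj). Qed.

Lemma witnesses_incl (x y : J R) v w :
  (kappa_shift C hC (val x) <= val y)%O -> wX x v w -> wY y (i v) w.
Proof.
move=> /andP[/= k r] [deg vw]; split; last exact: near_homo vw.
apply: le_trans (le_trans deg _).
  rewrite lerD2r; apply: (le_trans (ler_wpM2r _ k)); first exact: ler0n.
  (* The choice of [C] turns the threshold for [Y] into the one for [X]: [C * #|Y|] equals
     [#|X|]. *)
  by rewrite CE mulrAC divfK 1?mulrC ?lexx ?pnatr_eq0 -?lt0n.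
rewrite ler_nat (leq_trans (degree_image (f := i) (T := T (val x).2) _ _ _))//.
  by move=> s; rewrite ST.
by apply/degreeS/TS.
Qed.

(** The point [v] does not depend on [w], so a whole dual simplex with common point [y] acquires the
    common point [v]. *)
Lemma witnesses_project (x x' : J R) y :
  (gamma_shift delta hdelta (val x) <= val x')%O ->
  (val x).1 * #|Y|%:R - 1 <= (degree (T (val x).2) y)%:R :> R ->
  exists v, forall w, wY x y w -> wX x' v w.
Proof.
set k : R := (val x).1; set r : R := (val x).2.
have /andP[_ r0] := valP x; rewrite -/r in r0.
rewrite leRop_RE => /andP[/=]; rewrite -/k -/r => k' r' deg.
have /andP[k'0 _] := valP x'.
(* Adding [y] to its neighbours absorbs the [- 1] of the degree bound. *)
pose A := (y |: [set z | (z != y) && ([set y; z]%SET \in T r)])%SET.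
have AT a : a \in A -> [set y; a]%SET \in T r.
  rewrite finset.in_setU1 finset.in_set => /orP[/eqP ->|/andP[]//].
  by rewrite finset.setUid; exact: T_vertex.
have cardA : k * #|Y|%:R <= #|A|%:R :> R.
  rewrite cardsU1 finset.in_set eqxx/= natrD -lerBlDl.
  exact: deg.
set B := [set v : X | [exists a in A, dist (i v) a < delta]]%SET.
have cardB : (val x').1 * #|X|%:R <= #|B|%:R :> R.
  rewrite -ler_pdivlMr ?ltr0n//; apply: (le_trans k').
  rewrite lerBlDr; apply: le_trans (measure_le A).
  by rewrite ler_pdivlMr ?ltr0n.
have BP v : v \in B -> exists2 a, a \in A & dist (i v) a < delta.
  by rewrite finset.in_set => /exists_inP[a aA va]; exists a.
(* Here positivity of the first coordinate of [x'] makes [B] non-empty. *)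
have /card_gt0P[v0 v0B] : (0 < #|B|)%N.
  by rewrite -(ltr0n R); apply: lt_le_trans cardB; rewrite mulr_gt0 ?ltr0n.
have v0y : dist (i v0) y < 2 * r + delta.
  have [a aA v0a] := BP _ v0B.
  have ya := T_edge r0 (AT _ aA); rewrite dist_sym in ya.
  have := dist_triangle (i v0) a y; lra.
exists v0 => w [_ [s [s0 wT [z zw yz]]]]; split; last first.
  exists s; split => //; exists z => //.
  have := dist_triangle (i v0) y z; move: r' yz => /=; rewrite -/r; lra.
rewrite lerBlDl; apply: (le_trans cardB).
rewrite nat1r ler_nat.
have -> : (degree (S (val x').2) v0).+1 = #|(v0 |: [set v | (v != v0) &&
    ([set v0; v]%SET \in S (val x').2)])%SET|.
  by rewrite cardsU1 finset.in_set eqxx.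
(* All of [B] is adjacent or equal to [v0]: if [v] is within [delta] of [a], the edge from [y] to
   [a] at scale [r] witnesses both [v0], through [y], as [(2r + delta) + r = 3r + delta], and [v],
   through [a]. *)
apply/subset_leq_card/fintype.subsetP => v vB.
rewrite finset.in_setU1 finset.in_set; have [//|vv0/=] := eqVneq v v0.
have [a aA va] := BP _ vB.
rewrite ST; apply: (@T_near _ [set y; a]%SET).
  by rewrite finset.imset_eq0; apply/set0Pn; exists v0; rewrite finset.set21.
move=> _ /imsetP[v' v'v ->]; exists r; split => //; first exact: AT.
move: v'v; rewrite finset.in_set2 => /orP[/eqP ->|/eqP ->].
  exists y; first by rewrite finset.set21.
  move: r'; lra.
exists a; first by rewrite finset.set22.
move: r'; lra.
Qed.

Let kappa := kappa_shift C hC.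
Let gamma := gamma_shift delta hdelta.

Let dual (p : interl kappa gamma) : complex {set Y} :=
  if p.2 then dowker (fun w y => wY p.1 y w)
  else dowker (fun w v => wX p.1 v w).

Let dualS p q : (p <= q)%O -> dual p \subset dual q.
Proof.
case: p => x [] ; case: q => y [] /= xy; apply/fintype.subsetP => t;
  move=> /dowkerP[t0 [v vt]]; apply/dowkerP; split => //.
- by exists v => w /vt; exact: witnesses_homo.
(* The degree bound on the common point is read off from any one element of the non-empty [t]. *)
- have [w0 w0t] := set0Pn _ t0; have [deg _] := vt _ w0t.
  have [v' vv'] := witnesses_project xy deg.
  by exists v' => w /vt; exact: vv'.
- by exists (i v) => w /vt; exact: witnesses_incl.
- by exists v => w /vt; exact: witnesses_homo.
Qed.

Lemma ndeg_homotopy_interleaved : homotopy_interleaved kappa gamma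
  (ndeg_bifiltration SS) (ndeg_bifiltration TS).
Proof.
have idT r (s : {set Y}) : (s \in T r) = (id @: s \in T r).
  by rewrite finset.imset_id.
pose H := filtration (R := R) dualS.
exists (precomp H (interl_in kappa gamma false)).
exists (precomp H (interl_in kappa gamma true)).
split; last by exists H.
- rewrite precomp_filtration; apply: rst_sym.
  apply: (dowker_weakly_equivalent (r := wX)).
  + exact: witnesses_homo.
  + exact: ndeg_dowker.
  + by move=> x s; exact: dowkerP.
- rewrite precomp_filtration; apply: rst_sym.
  apply: (dowker_weakly_equivalent (r := wY)).
  + exact: witnesses_homo.
  + exact: ndeg_dowker.
  + by move=> x s; exact: dowkerP.
Qed.

End interleaving.

(** The elements of [t] may come with different scales [s]; by finiteness the least one serves for
    all, since decreasing [s] only relaxes the distance bound. *)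
Lemma near_common {R : realType} (Y : finType) (dist : Y -> Y -> R)
    (T : R -> complex Y) r (w t : {set Y}) : t != finset.set0 ->
  (forall y, y \in t -> near_simplex dist T r y w) ->
  exists s, [/\ 0 < s, w \in T s &
    forall y, y \in t -> exists2 z, z \in w & dist y z + s <= r].
Proof.
move=> /set0Pn[y0 y0t] tw.
have /choice[f fP] : forall y, exists s, y \in t ->
    [/\ 0 < s, w \in T s & exists2 z, z \in w & dist y z + s <= r].
  move=> y; have [/tw[s sP]|] := boolP (y \in t); first by exists s.
  by exists 0.
have [y yt ymin] := arg_minP f y0t.
have [fy0 fyw _] := fP y yt; exists (f y); split => // z zt.
have [_ _ [z' z'w zz']] := fP z zt; exists z' => //.
by apply: le_trans zz'; rewrite lerD2l ymin.
Qed.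

(** * From the Prohorov distance to cardinalities *)

Section measures.
Context {R : realType}.

(** Finite sets are closed in a metric space, so they occur in the supremum; the strict bound then
    yields an admissible value below [delta] in the infimum. *)
Lemma prohorov_finite {Z : metricType R} (m m' : borel_measure R Z)
    (delta : R) (A : set Z) : (prohorov m m' < delta%:E)%E -> finite_set A ->
  exists2 delta', delta' < delta &
    (m' A <= m (thickening A delta') + delta'%:E)%E.
Proof.
move=> lt_delta /(accessible_finite_set_closed.1
  (hausdorff_accessible (@metric_hausdorff _ Z))) cA.
have /ereal_inf_lt[_ [delta' [_ _ le_delta] <-]] :
    (ereal_inf [set e%:E | e in [set e : R | [/\ (0 <= e)%R,
      (m A <= m' (thickening A e) + e%:E)%E &
      (m' A <= m (thickening A e) + e%:E)%E]]] < delta%:E)%E.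
  by apply: le_lt_trans lt_delta; apply: ereal_sup_ubound; exists A.
by rewrite lte_fin; exists delta'.
Qed.

Lemma nu_card {Z : metricType R} (X : {fset Z}) (A : set Z) :
  nu X A = (#|[set x : X | val x \in A]%SET|%:R / #|{: X}|%:R)%:E.
Proof.
rewrite [LHS]nu_funE cardfE big_seq_fsetE/=; congr (_ / _)%:E.
rewrite -sum1_card natr_sum [RHS]big_mkcond/=; apply: eq_bigr => x _.
by rewrite indicE finset.in_set; case: (_ \in A).
Qed.

Lemma card_thickening_le {Z : metricType R} (V Y : finType) (f : V -> Z)
    (g : Y -> Z) (A : {set Y}) (delta delta' : R) : delta' <= delta ->
  (#|[set v : V | f v \in thickening (g @` [set` A]) delta']%SET| <=
   #|[set v : V | [exists a in A, (mdist (f v) (g a) < delta)%R]]%SET|)%N.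
Proof.
move=> dd'; apply/subset_leq_card/fintype.subsetP => v; rewrite !finset.in_set.
move=> /set_mem[_ [a aA <-] va]; apply/exists_inP; exists a => //.
exact: lt_le_trans dd'.
Qed.

End measures.

(** * Cech and Rips complexes *)

Section cech_complex.
Context {R : realType} {Z : metricType R}.
Implicit Types X Y : {fset Z}.

Lemma cechP X r (s : {set X}) : s \in cech X r <->
  s != finset.set0 /\ exists c, forall x, x \in s -> mdist (val x) c < r.
Proof.
rewrite finset.in_set; split => [/andP[s0 /asboolP[c sc]]|[s0 [c sc]]].
  by split => //; exists c => x xs; have := sc x xs; rewrite ballEmdist.
by rewrite s0; apply/asboolP; exists c => x /sc; rewrite ballEmdist.
Qed.

Lemma cech_sub_fset X Y (XY : (X `<=` Y)%fset) r (s : {set X}) :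
  (s \in cech X r) = (fincl XY @: s \in cech Y r).
Proof.
apply/idP/idP => /cechP[s0 [c sc]]; apply/cechP; split.
- by rewrite finset.imset_eq0.
- by exists c => _ /imsetP[x xs ->]; exact: sc.
- by rewrite finset.imset_eq0 in s0.
- by exists c => x xs; have := sc _ (imset_f (fincl XY) xs).
Qed.

Lemma cech_vertex X r (x : X) : 0 < r -> [set x]%SET \in cech X r.
Proof.
move=> r0; apply/cechP; split.
  by apply/set0Pn; exists x; rewrite finset.set11.
by exists (val x) => y /set1P ->; rewrite mdistxx.
Qed.

Lemma cech_edge X r (x y : X) : 0 < r -> [set x; y]%SET \in cech X r ->
  mdist (val x) (val y) < 2 * r.
Proof.
move=> r0 /cechP[_ [c xyc]].
have xc := xyc _ (finset.set21 x y); have := xyc _ (finset.set22 x y).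
have := metric_triangle (val x) c (val y); rewrite (metric_sym c).
lra.
Qed.

(** A common centre [c] of the balls of radius [s] around [w] is at distance less than [(r - s) + s]
    from each element of [t]. *)
Lemma cech_near X r (w t : {set X}) : t != finset.set0 ->
  (forall y, y \in t ->
    near_simplex (fun y z => mdist (val y) (val z)) (cech X) r y w) ->
  t \in cech X r.
Proof.
move=> t0 /(near_common t0)[s [s0 /cechP[_ [c wc]] tw]].
apply/cechP; split => //; exists c => y /tw[z /wc zc].
have := metric_triangle (val y) (val z) c; lra.
Qed.

End cech_complex.

Section rips_complex.
Context {R : realType} (X : finMetricType R).

Lemma ripsP r (s : {set X}) : s \in rips X r <-> s != finset.set0 /\
  forall x y, x \in s -> y \in s -> x != y -> mdist x y < 2 * r.
Proof.
rewrite finset.in_set; split => [/andP[s0 sr]|[s0 sr]].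
  split => // x y xs ys xy.
  move/forall_inP: sr => /(_ _ xs)/forall_inP/(_ _ ys).
  by rewrite /rips_edge xy.
rewrite s0; apply/forall_inP => x xs; apply/forall_inP => y ys.
by apply/implyP => xy; rewrite /rips_edge xy sr.
Qed.

Lemma rips_vertex r (x : X) : 0 < r -> [set x]%SET \in rips X r.
Proof.
move=> r0; apply/ripsP; split.
  by apply/set0Pn; exists x; rewrite finset.set11.
by move=> y z /set1P -> /set1P ->; rewrite eqxx.
Qed.

Lemma rips_edge_lt r (w : {set X}) x y : 0 < r -> w \in rips X r ->
  x \in w -> y \in w -> mdist x y < 2 * r.
Proof.
move=> r0 /ripsP[_ wr] xw yw; have [->|] := eqVneq x y; last exact: wr.
by rewrite mdistxx mulr_gt0.
Qed.

(** Two elements of [t] are at distance less than [(r - s) + 2s + (r - s) = 2r], passing through two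
    elements of [w]. *)
Lemma rips_near r (w t : {set X}) : t != finset.set0 ->
  (forall y, y \in t -> near_simplex (fun y z => mdist y z) (rips X) r y w) ->
  t \in rips X r.
Proof.
move=> t0 /(near_common t0)[s [s0 wT tw]].
apply/ripsP; split => // x y /tw[x' x'w xx'] /tw[y' y'w yy'] _.
have := rips_edge_lt s0 wT x'w y'w; rewrite (metric_sym y) in yy'.
have := metric_triangle x x' y; have := metric_triangle x' y' y; lra.
Qed.

End rips_complex.

Lemma rips_sub_fset {R : realType} (Y : finMetricType R) (X : {fset Y}) r
    (s : {set X}) :
  (s \in rips X r) = ((val : X -> Y) @: s \in rips Y r).
Proof.
apply/idP/idP => /ripsP[s0 sr]; apply/ripsP; split.
- by rewrite finset.imset_eq0.
- by move=> _ _ /imsetP[x xs ->] /imsetP[y ys ->] xy; exact: sr.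
- by rewrite finset.imset_eq0 in s0.
- by move=> x y xs ys xy; apply: sr; rewrite ?imset_f.
Qed.

Theorem proposition3p9 (R : realType) :
  (forall (Z : metricType R) (hZ : good_metric_space Z) (X Y : {fset Z})
      (X0 : X != fset0) (XY : (X `<=` Y)%fset)
      (delta : R) (hdelta : (prohorov (nu X) (nu Y) < delta%:E)%E),
    homotopy_interleaved
      (kappa_shift (#|` X|%:R / #|` Y|%:R) (card_ratio_fset X0 XY))
      (gamma_shift delta (prohorov_lt_ge0 hdelta))
      (degree_cech X) (degree_cech Y))
  /\
  (forall (Y : finMetricType R) (X : {fset Y}) (X0 : X != fset0)
      (delta : R)
      (hdelta : (prohorov
         (borel_pushforward (mu X) (val : X -> Y) (fsval_continuous X))
         (mu Y) < delta%:E)%E),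
    homotopy_interleaved
      (kappa_shift (#|` X|%:R / #|Y|%:R) (card_ratio_fin X0))
      (gamma_shift delta (prohorov_lt_ge0 hdelta))
      (degree_rips X) (degree_rips Y)).
Proof.
split=> [Z _ X Y X0 XY delta hdelta|Y X X0 delta hdelta].
  apply: (ndeg_homotopy_interleaved
    (dist := fun y z : Y => mdist (val y) (val z)) (i := fincl XY)).
  - exact: fincl_inj.
  - by move=> y; exact: mdistxx.
  - by move=> y z; exact: metric_sym.
  - by move=> x y z; exact: metric_triangle.
  - by move=> r s; exact: cech_sub_fset.
  - by move=> r y; exact: cech_vertex.
  - by move=> r y z; exact: cech_edge.
  - by move=> r w t; exact: cech_near.
  - by rewrite !cardfE.
  - by rewrite -cardfE cardfs_gt0.
  (* The Prohorov bound is applied to the finite set [A] seen in [Z], whose measure for [Y] is the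
     proportion of [A] in [Y]. *)
  - move=> A.
    have /(prohorov_finite hdelta)[delta' lt_delta] :
        finite_set ((val : Y -> Z) @` [set` A]) by exact: finite_image.
    rewrite !nu_card -EFinD lee_fin.
    rewrite (_ : [set _ | _]%SET = A); last first.
      apply/setP => y; rewrite finset.in_set.
      apply/idP/idP => [/set_mem[z zA]|yA].
        by move=> /val_inj <-.
      by apply/mem_set; exists y.
    move=> /le_trans; apply; apply: lerD; last exact: ltW.
    rewrite ler_wpM2r ?invr_ge0// ler_nat.
    exact: (card_thickening_le (val \o fincl XY) val A (ltW lt_delta)).
apply: (ndeg_homotopy_interleaved
  (dist := fun y z : Y => mdist y z) (i := (val : X -> Y))).
- exact: val_inj.
- by move=> y; exact: mdistxx.
- by move=> y z; exact: metric_sym.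
- by move=> x y z; exact: metric_triangle.
- by move=> r s; exact: rips_sub_fset.
- by move=> r y; exact: rips_vertex.
- by move=> r y z r0 yz; apply: (rips_edge_lt r0 yz);
    rewrite ?finset.set21 ?finset.set22.
- by move=> r w t; exact: rips_near.
- by rewrite cardfE.
- by rewrite -cardfE cardfs_gt0.
- move=> A.
  (* Writing [A] as an image under [id] gives the form expected by [card_thickening_le]. *)
  have /(prohorov_finite hdelta)[delta' lt_delta] :
      finite_set (id @` [set` A]) by exact: finite_image.
  rewrite [X in (X <= _)%E]/(mu_fun _) [X in (_ <= X + _)%E]/(mu_fun _).
  rewrite -EFinD lee_fin.
  rewrite (_ : [set _ | _]%SET = A); last first.
    apply/setP => y; rewrite finset.in_set image_id.
    by apply/idP/idP => [/set_mem//|yA]; exact/mem_set.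
  move=> /le_trans; apply; apply: lerD; last exact: ltW.
  rewrite ler_wpM2r ?invr_ge0// ler_nat.
  exact: (card_thickening_le (val : X -> Y) id A (ltW lt_delta)).
Qed.
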